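(* Fix $k\in\mathbb N_0^2\setminus\{0\}$ and a nonzero $\xi_k=a_ke_k+\overline{a_k}e_{-k}+(-1)^{k_2+1}\overline{a_k}e_{\bar k}+(-1)^{k_2+1}a_ke_{-\bar k}$, and let $\kappa=\arctan(k_2/k_1)\in[0,\pi/2]$. Let $(l_m)_{m}$ be a sequence in $\mathbb N_0^2$ with $(l_m)_1\neq k_1$, $(l_m)_2\neq k_2$, $\|l_m\|\to\infty$ and $l_m/\|l_m\|\to l$, and put $\lambda=\arctan(l_2/l_1)\in[0,\pi/2]$. Let $\eta_{l_m}=b_me_{l_m}+\overline{b_m}e_{-l_m}+(-1)^{(l_m)_2+1}\overline{b_m}e_{\bar l_m}+(-1)^{(l_m)_2+1}b_me_{-\bar l_m}$ be nonzero ($b_m\in\mathbb C$). Then $$\lim_{m\to\infty}C(\xi_k,\eta_{l_m})=-\frac{\|k\|^2}{2S_{\mathbb T}}\big(\sin^4(\lambda-\kappa)+\sin^4(\lambda+\kappa)\big).$$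
   Context: $\mathbb T=\mathbb R^2/(2\pi\mathbb Z)^2$, area $S_{\mathbb T}=4\pi^2$, $I(x_1,x_2)=(2\pi-x_1,\pi+x_2)$, $\mathbb K=\mathbb T/I$; $C$ is the sectional curvature of $\mathrm{SDiff}(\mathbb K)$, whose Lie algebra is identified with real smooth zero-mean $f$ on $\mathbb T$ with $f\circ I=-f$, with bracket $\{f,g\}=\partial_{x_2}f\partial_{x_1}g-\partial_{x_1}f\partial_{x_2}g$, inner product $\langle f,g\rangle=\int_{\mathbb T}\nabla f\cdot\nabla g$, and $C(u,v)=\langle R(u,v)u,v\rangle/(\langle u,u\rangle\langle v,v\rangle-\langle u,v\rangle^2)$ where $R(u,v)w=-\nabla_u\nabla_vw+\nabla_v\nabla_uw+\nabla_{\{u,v\}}w$, $\nabla_uv=\frac12(\{u,v\}-B(u,v)-B(v,u))$, $\langle B(u,v),w\rangle=\langle u,\{v,w\}\rangle$. $e_k=e^{i(k_1x_1+k_2x_2)}$, $\bar k=(k_1,-k_2)$, $\|k\|^2=k_1^2+k_2^2$; $\arctan(x/0)=\pi/2$ for $x>0$. *)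

(* Defs.v *)
From Stdlib Require Import Reals Lra ClassicalEpsilon.
From Coquelicot Require Import Coquelicot.
Open Scope R_scope.

(* Functions on the torus are represented as 2pi-periodic functions R -> R -> R
   of the coordinates (x1, x2). *)
Definition fn := R -> R -> R.

Definition Dx1 (f : fn) : fn := fun x1 x2 => Derive (fun t => f t x2) x1.
Definition Dx2 (f : fn) : fn := fun x1 x2 => Derive (fun t => f x1 t) x2.

Fixpoint iterD (s : list bool) (f : fn) : fn :=
  match s with
  | nil => f
  | cons true s' => Dx1 (iterD s' f)
  | cons false s' => Dx2 (iterD s' f)
  end.

Definition smooth (f : fn) : Prop :=
  forall (s : list bool),
    (forall x1 x2, ex_derive (fun t => iterD s f t x2) x1 /\
                   ex_derive (fun t => iterD s f x1 t) x2) /\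
    (forall p : R * R,
       continuous (fun q : R * R => iterD s f (fst q) (snd q)) p).

Definition periodic (f : fn) : Prop :=
  forall x1 x2, f (x1 + 2 * PI) x2 = f x1 x2 /\ f x1 (x2 + 2 * PI) = f x1 x2.

Definition intT (g : fn) : R :=
  RInt (fun x1 => RInt (fun x2 => g x1 x2) 0 (2 * PI)) 0 (2 * PI).

Definition zero_mean (f : fn) : Prop := intT f = 0.

Definition I_odd (f : fn) : Prop :=
  forall x1 x2, f (2 * PI - x1) (PI + x2) = - f x1 x2.

(* the Lie algebra of SDiff(K) *)
Definition lie (f : fn) : Prop :=
  smooth f /\ periodic f /\ zero_mean f /\ I_odd f.

Definition fadd (f g : fn) : fn := fun x1 x2 => f x1 x2 + g x1 x2.
Definition fopp (f : fn) : fn := fun x1 x2 => - f x1 x2.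
Definition fscal (c : R) (f : fn) : fn := fun x1 x2 => c * f x1 x2.
Definition fzero : fn := fun _ _ => 0.

Definition br (f g : fn) : fn :=
  fun x1 x2 => Dx2 f x1 x2 * Dx1 g x1 x2 - Dx1 f x1 x2 * Dx2 g x1 x2.

Definition ip (f g : fn) : R :=
  intT (fun x1 x2 => Dx1 f x1 x2 * Dx1 g x1 x2 + Dx2 f x1 x2 * Dx2 g x1 x2).

(* B(u,v): the element of the Lie algebra with <B(u,v),w> = <u,{v,w}> for all w
   in the Lie algebra (unique when it exists). *)
Definition Bop (u v : fn) : fn :=
  epsilon (inhabits fzero)
    (fun w0 => lie w0 /\ forall w, lie w -> ip w0 w = ip u (br v w)).

Definition nabla (u v : fn) : fn :=
  fscal (1/2) (fadd (br u v) (fopp (fadd (Bop u v) (Bop v u)))).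

Definition Rcurv (u v w : fn) : fn :=
  fadd (fadd (fopp (nabla u (nabla v w))) (nabla v (nabla u w))) (nabla (br u v) w).

Definition sec_curv (u v : fn) : R :=
  ip (Rcurv u v u) v / (ip u u * ip v v - (ip u v) ^ 2).

Definition ek (k1 k2 : R) (x1 x2 : R) : C :=
  (cos (k1 * x1 + k2 * x2), sin (k1 * x1 + k2 * x2)).

(* a e_k + conj(a) e_{-k} + (-1)^(k2+1) conj(a) e_{kbar} + (-1)^(k2+1) a e_{-kbar}
   (this sum is real-valued; we take its real part) *)
Definition mode (a : C) (k : nat * nat) : fn :=
  fun x1 x2 =>
    let k1 := INR (fst k) in
    let k2 := INR (snd k) in
    let s : C := RtoC ((-1) ^ (snd k + 1)) in
    Re (Cplus (Cplus (Cmult a (ek k1 k2 x1 x2))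
                     (Cmult (Cconj a) (ek (- k1) (- k2) x1 x2)))
              (Cplus (Cmult s (Cmult (Cconj a) (ek k1 (- k2) x1 x2)))
                     (Cmult s (Cmult a (ek (- k1) k2 x1 x2))))).

Definition ang (x y : R) : R :=
  if Req_EM_T x 0 then PI / 2 else atan (y / x).

Definition S_T : R := 4 * PI ^ 2.

(* Main.v *)
From Corelib Require Import ssreflect.
Require Import Defs.
From Stdlib Require Import Reals Lra Lia ClassicalEpsilon FunctionalExtensionality.
From Coquelicot Require Import Coquelicot.
Open Scope R_scope.

(** For trigonometric polynomials the operator [B(f, h)] is the unique solution [W] of
    [Delta W = {Delta f, h}].  Hence for Laplace eigenfunctions [u, v] with eigenvalues
    [-K, -L] and [g = {u, v}], integration by parts gives
    [4 <R(u,v)u, v> = - (L - K)^2 <g, Delta^-1 g> + 2 (K + L) <g, g> + 3 <g, Delta g>]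
    with [L^2] inner products, so that a component of [g] of frequency [q] contributes in
    proportion to [(L - K)^2 / |q|^2 + 2 (K + L) - 3 |q|^2].  The modes are products of sines,
    and their bracket has four components, of frequencies [(k1 +- l1, k2 +- l2)].  With
    [x = k.l], the contributions of [k + l] and [k - l] add up to a multiple of
    [(K + L) (k x l)^4 / ((K + L)^2 - 4 x^2)]; their leading terms, which
    are linear in [x], cancel. *)

(** * Smooth functions and their integrals *)

(** [Bop] is a choice operator, so nothing is known about it until a solution is shown to exist in
    the Lie algebra and to be unique there. Uniqueness is proved for all smooth elements; existence
    only for I-odd trigonometric polynomials, where the Laplacian is inverted term by term. That
    class is stable under brackets, [Lap] and [Bop], so every covariant derivative in the curvature
    stays inside it. Behind the cancellation: the squared frequencies of k + l and k - l are s + 2 x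
    and s - 2 x with s = K + L, so the two weights add up to 2 s ((L - K)^2 / (s^2 - 4 x^2) - 1).
    With d the determinant of k and l, (L - K)^2 - s^2 = - 4 K L and K L - x^2 = d^2 turn this into
    - 8 s d^2 / (s^2 - 4 x^2); the squared amplitude of the components supplies the other factor
    d^2. The conditions on the coordinates of k and l make the modes orthogonal and all four
    frequencies nonzero. If a coordinate is zero, some components coincide; they then reinforce each
    other, and the excess cancels against the norms of the modes. *)

Lemma fn_ext (f g : fn) : (forall x y, f x y = g x y) -> f = g.
Proof.
  intros H; apply functional_extensionality; intros x.
  now apply functional_extensionality.
Qed.

Definition fmul (f g : fn) : fn := fun x y => f x y * g x y.

Definition regular (f : fn) : Prop :=
  (forall x1 x2, ex_derive (fun t => f t x2) x1 /\ ex_derive (fun t => f x1 t) x2) /\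
  (forall p : R * R, continuous (fun q : R * R => f (fst q) (snd q)) p).

(** Smoothness quantifies over all words of derivatives; a class stable under both derivatives
    reduces it to one differentiation step. *)
Lemma smooth_coind (P : fn -> Prop) :
  (forall f, P f -> regular f /\ P (Dx1 f) /\ P (Dx2 f)) ->
  forall f, P f -> smooth f.
Proof.
  intros HP f Hf s.
  assert (H : P (iterD s f)).
  { induction s as [|[] s IH]; simpl; [exact Hf | |]; now apply HP. }
  now apply HP.
Qed.

Lemma iterD_app s s' f : iterD (s ++ s') f = iterD s (iterD s' f).
Proof. induction s as [|[] s IH]; simpl; now rewrite ?IH. Qed.

Lemma smooth_regular f : smooth f -> regular f.
Proof. intros H; exact (H nil). Qed.

Lemma smooth_Dx1 f : smooth f -> smooth (Dx1 f).
Proof. intros H s. rewrite <- (iterD_app s (true :: nil)). apply H. Qed.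

Lemma smooth_Dx2 f : smooth f -> smooth (Dx2 f).
Proof. intros H s. rewrite <- (iterD_app s (false :: nil)). apply H. Qed.

Lemma regular_fadd f g : regular f -> regular g -> regular (fadd f g).
Proof.
  intros [Df Cf] [Dg Cg]; split.
  - intros x y; destruct (Df x y), (Dg x y); split; apply: ex_derive_plus; assumption.
  - intros p; apply: continuous_plus; [apply Cf | apply Cg].
Qed.

Lemma regular_fmul f g : regular f -> regular g -> regular (fmul f g).
Proof.
  intros [Df Cf] [Dg Cg]; split.
  - intros x y; destruct (Df x y), (Dg x y); split; apply ex_derive_mult; assumption.
  - intros p; apply: continuous_mult; [apply Cf | apply Cg].
Qed.

Lemma Dx1_fadd f g : regular f -> regular g -> Dx1 (fadd f g) = fadd (Dx1 f) (Dx1 g).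
Proof.
  intros [Df _] [Dg _]; apply fn_ext; intros x y; unfold Dx1, fadd.
  rewrite Derive_plus. reflexivity. exact (proj1 (Df x y)). exact (proj1 (Dg x y)). Qed.

Lemma Dx2_fadd f g : regular f -> regular g -> Dx2 (fadd f g) = fadd (Dx2 f) (Dx2 g).
Proof.
  intros [Df _] [Dg _]; apply fn_ext; intros x y; unfold Dx2, fadd.
  rewrite Derive_plus. reflexivity. exact (proj2 (Df x y)). exact (proj2 (Dg x y)). Qed.

Lemma Dx1_fmul f g : regular f -> regular g ->
  Dx1 (fmul f g) = fadd (fmul (Dx1 f) g) (fmul f (Dx1 g)).
Proof. intros [Df _] [Dg _]; apply fn_ext; intros x y.
  unfold fadd, fmul, Dx1; rewrite Derive_mult; [reflexivity | exact (proj1 (Df x y)) | exact (proj1 (Dg x y))]. Qed.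

Lemma Dx2_fmul f g : regular f -> regular g ->
  Dx2 (fmul f g) = fadd (fmul (Dx2 f) g) (fmul f (Dx2 g)).
Proof. intros [Df _] [Dg _]; apply fn_ext; intros x y.
  unfold fadd, fmul, Dx2; rewrite Derive_mult; [reflexivity | exact (proj2 (Df x y)) | exact (proj2 (Dg x y))]. Qed.

Lemma Dx1_fscal c f : Dx1 (fscal c f) = fscal c (Dx1 f).
Proof. apply fn_ext; intros x y; unfold Dx1, fscal; apply Derive_scal. Qed.

Lemma Dx2_fscal c f : Dx2 (fscal c f) = fscal c (Dx2 f).
Proof. apply fn_ext; intros x y; unfold Dx2, fscal; apply Derive_scal. Qed.

(** The product rule turns a product into a sum of products, so the invariant for [smooth_coind]
    must be closed under both operations. *)
Inductive smooth_alg : fn -> Prop :=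
| smooth_alg_base f : smooth f -> smooth_alg f
| smooth_alg_add f g : smooth_alg f -> smooth_alg g -> smooth_alg (fadd f g)
| smooth_alg_mul f g : smooth_alg f -> smooth_alg g -> smooth_alg (fmul f g).

Lemma smooth_alg_smooth f : smooth_alg f -> smooth f.
Proof.
  apply smooth_coind; clear f.
  induction 1 as [f Hf | f g Hf IHf Hg IHg | f g Hf IHf Hg IHg].
  - split; [now apply smooth_regular|].
    split; apply smooth_alg_base; [now apply smooth_Dx1 | now apply smooth_Dx2].
  - destruct IHf as (Rf & Af & Bf), IHg as (Rg & Ag & Bg).
    rewrite (Dx1_fadd f g Rf Rg) (Dx2_fadd f g Rf Rg).
    split; [now apply regular_fadd | split; now apply smooth_alg_add].
  - destruct IHf as (Rf & Af & Bf), IHg as (Rg & Ag & Bg).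
    rewrite (Dx1_fmul f g Rf Rg) (Dx2_fmul f g Rf Rg).
    split; [now apply regular_fmul|].
    split; apply smooth_alg_add; now apply smooth_alg_mul.
Qed.

Lemma smooth_fadd f g : smooth f -> smooth g -> smooth (fadd f g).
Proof. intros Hf Hg; apply smooth_alg_smooth, smooth_alg_add; now apply smooth_alg_base. Qed.

Lemma smooth_fmul f g : smooth f -> smooth g -> smooth (fmul f g).
Proof. intros Hf Hg; apply smooth_alg_smooth, smooth_alg_mul; now apply smooth_alg_base. Qed.

Lemma smooth_const c : smooth (fun _ _ => c).
Proof.
  apply (smooth_coind (fun f => exists c, f = fun _ _ => c)); [clear c | now exists c].
  intros f [c ->]; split; [split|].
  - intros x y; split; apply: ex_derive_const.
  - intros p; apply: continuous_const.
  - split; exists 0; apply fn_ext; intros x y; exact (Derive_const c _).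
Qed.

Lemma smooth_fscal c f : smooth f -> smooth (fscal c f).
Proof. intros Hf; apply (smooth_fmul (fun _ _ => c)); [apply smooth_const | exact Hf]. Qed.

Lemma smooth_ex_derive1 f x y : smooth f -> ex_derive (fun t => f t y) x.
Proof. intros Hf; exact (proj1 (proj1 (smooth_regular f Hf) x y)). Qed.

Lemma smooth_ex_derive2 f x y : smooth f -> ex_derive (fun t => f x t) y.
Proof. intros Hf; exact (proj2 (proj1 (smooth_regular f Hf) x y)). Qed.

Lemma smooth_cont2 f x y : smooth f -> continuity_2d_pt f x y.
Proof.
  intros Hf; apply continuity_2d_pt_filterlim.
  exact (proj2 (smooth_regular f Hf) (x, y)).
Qed.

Lemma smooth_Dx12 f : smooth f -> Dx1 (Dx2 f) = Dx2 (Dx1 f).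
Proof.
  intros Hf; apply fn_ext; intros x y.
  apply Schwarz.
  - exists (mkposreal _ Rlt_0_1); intros u v _ _.
    split; [now apply (smooth_ex_derive1 f)|]; split; [now apply (smooth_ex_derive2 f)|].
    split; [apply (smooth_ex_derive1 (Dx2 f)); now apply smooth_Dx2|].
    apply (smooth_ex_derive2 (Dx1 f)); now apply smooth_Dx1.
  - apply (smooth_cont2 (Dx1 (Dx2 f))). now apply smooth_Dx1, smooth_Dx2.
  - apply (smooth_cont2 (Dx2 (Dx1 f))). now apply smooth_Dx2, smooth_Dx1.
Qed.

Lemma smooth_ex_RInt2 f x a b : smooth f -> ex_RInt (fun y => f x y) a b.
Proof.
  intros Hf; apply: ex_RInt_continuous; intros y _.
  apply: ex_derive_continuous; now apply smooth_ex_derive2.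
Qed.

(** Differentiation under the inner integral yields the continuity of the outer integrand and
    reduces [intT_Dx1] to the fundamental theorem of calculus. *)
Lemma is_derive_int2 f x a b : smooth f ->
  is_derive (fun x => RInt (fun y => f x y) a b) x (RInt (fun y => Dx1 f x y) a b).
Proof.
  intros Hf; apply is_derive_RInt_param.
  - apply filter_forall; intros z t _; now apply smooth_ex_derive1.
  - intros t _; apply (smooth_cont2 (Dx1 f)); now apply smooth_Dx1.
  - apply filter_forall; intros z; now apply smooth_ex_RInt2.
Qed.

Lemma int2_continuous f x a b : smooth f ->
  continuous (fun x => RInt (fun y => f x y) a b) x.
Proof.
  intros Hf; apply: ex_derive_continuous; eexists; now apply is_derive_int2.
Qed.

Lemma smooth_ex_RInt1 f a b c d : smooth f ->
  ex_RInt (fun x => RInt (fun y => f x y) a b) c d.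
Proof.
  intros Hf; apply: ex_RInt_continuous; intros x _; now apply int2_continuous.
Qed.

Lemma intT_fadd f g : smooth f -> smooth g -> intT (fadd f g) = intT f + intT g.
Proof.
  intros Hf Hg; unfold intT.
  rewrite <- (RInt_plus (V := R_CompleteNormedModule)) by now apply smooth_ex_RInt1.
  apply RInt_ext; intros x _.
  rewrite <- (RInt_plus (V := R_CompleteNormedModule)) by now apply smooth_ex_RInt2.
  reflexivity.
Qed.

Lemma intT_fscal c f : smooth f -> intT (fscal c f) = c * intT f.
Proof.
  intros Hf; unfold intT.
  rewrite <- (RInt_scal (V := R_CompleteNormedModule)) by now apply smooth_ex_RInt1.
  apply RInt_ext; intros x _.
  rewrite <- (RInt_scal (V := R_CompleteNormedModule)) by now apply smooth_ex_RInt2.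
  reflexivity.
Qed.

Lemma intT_Dx1 f : smooth f -> periodic f -> intT (Dx1 f) = 0.
Proof.
  intros Hf Pf; unfold intT.
  rewrite (is_RInt_unique (V := R_CompleteNormedModule) _ _ _ _
    (is_RInt_derive (V := R_CompleteNormedModule)
      (fun x => RInt (fun y => f x y) 0 (2 * PI)) _ 0 (2 * PI)
      (fun x _ => is_derive_int2 f x _ _ Hf)
      (fun x _ => int2_continuous (Dx1 f) x _ _ (smooth_Dx1 _ Hf)))).
  assert (E : RInt (fun y => f (2 * PI) y) 0 (2 * PI) = RInt (fun y => f 0 y) 0 (2 * PI)).
  { apply RInt_ext; intros y _. rewrite <- (proj1 (Pf 0 y)). now rewrite Rplus_0_l. }
  rewrite E. apply Rminus_diag_eq; reflexivity.
Qed.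

Lemma intT_Dx2 f : smooth f -> periodic f -> intT (Dx2 f) = 0.
Proof.
  intros Hf Pf; unfold intT.
  rewrite (RInt_ext _ (fun _ => 0)).
  - rewrite RInt_const. apply Rmult_0_r.
  - intros x _. unfold Dx2.
    rewrite RInt_Derive.
    + rewrite -(proj2 (Pf x 0)) Rplus_0_l. apply Rminus_diag_eq; reflexivity.
    + intros y _; now apply smooth_ex_derive2.
    + intros y _; apply: (ex_derive_continuous (fun y => Dx2 f x y)).
      apply (smooth_ex_derive2 (Dx2 f)); now apply smooth_Dx2.
Qed.

Lemma periodic_Dx1 f : periodic f -> periodic (Dx1 f).
Proof.
  intros Pf x y; split; unfold Dx1.
  - transitivity (Derive (fun t => f (t + 2 * PI) y) x).
    (* Both derivatives are limits of the same difference quotient, up to the order of the summands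
       2 pi and h. *)
    + unfold Derive. f_equal. apply Lim_ext; intros h. f_equal. f_equal. f_equal. ring.
    + apply Derive_ext; intros t; exact (proj1 (Pf t y)).
  - apply Derive_ext; intros t; exact (proj2 (Pf t y)).
Qed.

Lemma periodic_Dx2 f : periodic f -> periodic (Dx2 f).
Proof.
  intros Pf x y; split; unfold Dx2.
  - apply Derive_ext; intros t; exact (proj1 (Pf x t)).
  - transitivity (Derive (fun t => f x (t + 2 * PI)) y).
    + unfold Derive. f_equal. apply Lim_ext; intros h. f_equal. f_equal. f_equal. ring.
    + apply Derive_ext; intros t; exact (proj2 (Pf x t)).
Qed.

Lemma periodic_fadd f g : periodic f -> periodic g -> periodic (fadd f g).
Proof. intros Hf Hg x y; unfold fadd; destruct (Hf x y) as [-> ->], (Hg x y) as [-> ->]; auto. Qed.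

Lemma periodic_fmul f g : periodic f -> periodic g -> periodic (fmul f g).
Proof. intros Hf Hg x y; unfold fmul; destruct (Hf x y) as [-> ->], (Hg x y) as [-> ->]; auto. Qed.

Lemma periodic_fscal c f : periodic f -> periodic (fscal c f).
Proof. intros Hf x y; unfold fscal; destruct (Hf x y) as [-> ->]; auto. Qed.

(** * Green formulas on the torus *)

Definition sper (f : fn) : Prop := smooth f /\ periodic f.
Definition Lap (f : fn) : fn := fadd (Dx1 (Dx1 f)) (Dx2 (Dx2 f)).
Definition L2 (f g : fn) : R := intT (fmul f g).

Lemma sper_fadd f g : sper f -> sper g -> sper (fadd f g).
Proof. intros [] []; split; [now apply smooth_fadd | now apply periodic_fadd]. Qed.
Lemma sper_fmul f g : sper f -> sper g -> sper (fmul f g).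
Proof. intros [] []; split; [now apply smooth_fmul | now apply periodic_fmul]. Qed.
Lemma sper_fscal c f : sper f -> sper (fscal c f).
Proof. intros []; split; [now apply smooth_fscal | now apply periodic_fscal]. Qed.
Lemma sper_Dx1 f : sper f -> sper (Dx1 f).
Proof. intros []; split; [now apply smooth_Dx1 | now apply periodic_Dx1]. Qed.
Lemma sper_Dx2 f : sper f -> sper (Dx2 f).
Proof. intros []; split; [now apply smooth_Dx2 | now apply periodic_Dx2]. Qed.

Create HintDb sper discriminated.
#[global] Hint Constants Opaque : sper.
#[global] Hint Resolve sper_fadd sper_fmul sper_fscal sper_Dx1 sper_Dx2 : sper.

Lemma sper_Lap f : sper f -> sper (Lap f).
Proof. unfold Lap; auto with sper. Qed.

Lemma br_eq f g :
  br f g = fadd (fmul (Dx2 f) (Dx1 g)) (fscal (-1) (fmul (Dx1 f) (Dx2 g))).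
Proof. apply fn_ext; intros x y; unfold br, fadd, fmul, fscal; ring. Qed.

Lemma sper_br f g : sper f -> sper g -> sper (br f g).
Proof. rewrite br_eq; auto with sper. Qed.

#[global] Hint Resolve sper_Lap sper_br : sper.

Lemma sper_regular f : sper f -> regular f.
Proof. intros []; now apply smooth_regular. Qed.

Lemma sper_smooth f : sper f -> smooth f.
Proof. now intros []. Qed.

Lemma sper_periodic f : sper f -> periodic f.
Proof. now intros []. Qed.

#[global] Hint Resolve sper_regular sper_smooth sper_periodic : sper.

Lemma fopp_fscal f : fopp f = fscal (-1) f.
Proof. apply fn_ext; intros x y; unfold fopp, fscal; ring. Qed.

Lemma L2_sym f g : L2 f g = L2 g f.
Proof. unfold L2; f_equal; apply fn_ext; intros x y; apply Rmult_comm. Qed.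

Lemma L2_fadd_l f g h : sper f -> sper g -> sper h -> L2 (fadd f g) h = L2 f h + L2 g h.
Proof.
  intros [Hf _] [Hg _] [Hh _]; unfold L2.
  rewrite -intT_fadd; auto using smooth_fmul.
  f_equal; apply fn_ext; intros x y; apply Rmult_plus_distr_r.
Qed.

Lemma L2_fscal_l c f h : sper f -> sper h -> L2 (fscal c f) h = c * L2 f h.
Proof.
  intros [Hf _] [Hh _]; unfold L2.
  rewrite -intT_fscal; auto using smooth_fmul.
  f_equal; apply fn_ext; intros x y; apply Rmult_assoc.
Qed.

Lemma L2_fadd_r f g h : sper f -> sper g -> sper h -> L2 h (fadd f g) = L2 h f + L2 h g.
Proof. intros; rewrite !(L2_sym h); now apply L2_fadd_l. Qed.

Lemma L2_fscal_r c f h : sper f -> sper h -> L2 h (fscal c f) = c * L2 h f.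
Proof. intros; rewrite !(L2_sym h); now apply L2_fscal_l. Qed.

Lemma L2_Dx1 f g : sper f -> sper g -> L2 (Dx1 f) g = - L2 f (Dx1 g).
Proof.
  intros Hf Hg.
  assert (H : intT (Dx1 (fmul f g)) = 0) by (apply intT_Dx1; auto with sper).
  rewrite Dx1_fmul in H; auto with sper.
  rewrite intT_fadd in H; auto with sper; unfold L2; lra.
Qed.

Lemma L2_Dx2 f g : sper f -> sper g -> L2 (Dx2 f) g = - L2 f (Dx2 g).
Proof.
  intros Hf Hg.
  assert (H : intT (Dx2 (fmul f g)) = 0) by (apply intT_Dx2; auto with sper).
  rewrite Dx2_fmul in H; auto with sper.
  rewrite intT_fadd in H; auto with sper; unfold L2; lra.
Qed.

Lemma ip_L2 f g : sper f -> sper g -> ip f g = - L2 (Lap f) g.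
Proof.
  intros Hf Hg.
  unfold Lap; rewrite L2_fadd_l; auto with sper.
  rewrite L2_Dx1; auto with sper. rewrite L2_Dx2; auto with sper.
  transitivity (L2 (Dx1 f) (Dx1 g) + L2 (Dx2 f) (Dx2 g)); [|ring].
  unfold L2; rewrite -intT_fadd; auto with sper.
Qed.

Lemma ip_sym f g : ip f g = ip g f.
Proof. unfold ip; f_equal; apply fn_ext; intros x y; ring. Qed.

Lemma Lap_sym f g : sper f -> sper g -> L2 (Lap f) g = L2 f (Lap g).
Proof.
  intros Hf Hg; apply Ropp_eq_reg.
  rewrite (L2_sym f) -!ip_L2; auto with sper; apply ip_sym.
Qed.

Lemma br_antisym f g : br f g = fscal (-1) (br g f).
Proof. apply fn_ext; intros x y; unfold br, fscal; ring. Qed.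

(** The Hamiltonian field of [g] is divergence-free: after integration by parts the terms with mixed
    derivatives of [g] cancel. This invariance moves [w] out of the bracket in <u, {v, w}> and so
    determines [Bop]. *)
Lemma L2_br_shift f g h : sper f -> sper g -> sper h -> L2 (br f g) h = L2 f (br g h).
Proof.
  intros Hf Hg Hh.
  assert (E1 := L2_Dx2 f (fmul (Dx1 g) h) Hf (sper_fmul _ _ (sper_Dx1 _ Hg) Hh)).
  assert (E2 := L2_Dx1 f (fmul (Dx2 g) h) Hf (sper_fmul _ _ (sper_Dx2 _ Hg) Hh)).
  rewrite Dx2_fmul in E1; auto with sper.
  rewrite Dx1_fmul in E2; auto with sper.
  rewrite L2_fadd_r in E1; auto with sper.
  rewrite L2_fadd_r in E2; auto with sper.
  rewrite (smooth_Dx12 g (proj1 Hg)) in E2.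
  rewrite !br_eq.
  rewrite L2_fadd_l; auto with sper.
  rewrite L2_fadd_r; auto with sper.
  rewrite L2_fscal_l; auto with sper.
  rewrite L2_fscal_r; auto with sper.
  assert (A : forall a b c, L2 (fmul a b) c = L2 a (fmul b c)).
  { intros; unfold L2; f_equal; apply fn_ext; intros x y; apply Rmult_assoc. }
  rewrite !A E1 E2; ring.
Qed.

(** * Definiteness of the inner product *)

Lemma periodic_nonneg_int_eq0 (f : R -> R) :
  (forall x, continuous f x) -> (forall x, 0 <= f x) ->
  (forall x, f (x + 2 * PI) = f x) -> RInt f 0 (2 * PI) = 0 -> forall x, f x = 0.
Proof.
  intros Cf Pf Tf If x.
  assert (HPI := PI_RGT_0).
  assert (Ex : forall a b, ex_RInt f a b) by (intros; apply: ex_RInt_continuous; auto).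
  (* The primitive is monotone and, the integral over a period being 0, periodic. Hence it is
     constant and its derivative [f] vanishes. *)
  set (F := fun x => RInt f 0 x).
  assert (Ch : forall a b, F b = F a + RInt f a b).
  { intros a b; symmetry; apply (RInt_Chasles (V := R_CompleteNormedModule)); auto. }
  assert (Mon : forall a b, a <= b -> F a <= F b).
  { intros a b Hab; rewrite (Ch a b).
    assert (0 <= RInt f a b) by (apply RInt_ge_0; auto). lra. }
  assert (Per : forall a, F (a + 2 * PI) = F a).
  { intros a; rewrite (Ch (2 * PI)). unfold F at 1; rewrite If.
    assert (E := RInt_comp_lin (V := R_CompleteNormedModule) f 1 (2 * PI) 0 a (Ex _ _)).
    rewrite Rmult_0_r Rmult_1_l Rplus_0_l in E; rewrite -E Rplus_0_l.
    apply RInt_ext; intros t _.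
    rewrite -(Tf t) Rmult_1_l; apply: Rmult_1_l. }
  assert (D : is_derive F x (f x)).
  { apply: (is_derive_RInt f F 0 x); [|apply Cf].
    apply filter_forall; intros y; apply (RInt_correct (V := R_CompleteNormedModule)); auto. }
  assert (D0 : is_derive F x 0).
  { apply (is_derive_ext_loc (fun _ => F (x - PI))); [| apply: is_derive_const].
    (* Within distance pi of x, y lies between x - pi and x - pi + 2 pi, two points where [F] takes
       the same value. *)
    exists (mkposreal _ HPI); intros y Hy.
    apply Rabs_lt_between in Hy; unfold minus, plus, opp in Hy; simpl in Hy.
    apply Rle_antisym; [apply Mon; lra|].
    rewrite -(Per (x - PI)); apply Mon; lra. }
  now rewrite -(is_derive_unique _ _ _ D) (is_derive_unique _ _ _ D0).
Qed.

Lemma intT_nonneg_eq0 (f : fn) :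
  sper f -> (forall x y, 0 <= f x y) -> intT f = 0 -> forall x y, f x y = 0.
Proof.
  intros [Sf Pf] Hf If x y.
  assert (HPI := PI_RGT_0).
  apply (periodic_nonneg_int_eq0 (fun y => f x y)); auto.
  - intros z; apply: ex_derive_continuous; now apply smooth_ex_derive2.
  - intros z; apply Pf.
  - apply (periodic_nonneg_int_eq0 (fun x => RInt (fun y => f x y) 0 (2 * PI))); auto.
    + intros z; now apply int2_continuous.
    + intros z; apply RInt_ge_0; auto; [lra | now apply smooth_ex_RInt2].
    + intros z; apply RInt_ext; intros t _; apply Pf.
Qed.

Lemma intT_const c : intT (fun _ _ => c) = 4 * PI ^ 2 * c.
Proof.
  unfold intT. rewrite (RInt_ext _ (fun _ => 2 * PI * c)).
  - rewrite RInt_const; unfold scal; simpl; unfold mult; simpl; ring.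
  - intros x _; rewrite RInt_const; unfold scal; simpl; unfold mult; simpl; ring.
Qed.

Lemma sper_fzero : sper fzero.
Proof. split; [exact (smooth_const 0) | intros x y; split; reflexivity]. Qed.

(** A function with zero gradient is constant, and zero mean leaves only the constant 0. The
    uniqueness of [Bop] rests on this. *)
Lemma ip_definite d : sper d -> zero_mean d -> ip d d = 0 -> d = fzero.
Proof.
  intros Hd Md Id.
  assert (H1 := sper_Dx1 _ Hd); assert (H2 := sper_Dx2 _ Hd).
  assert (Z := intT_nonneg_eq0 (fadd (fmul (Dx1 d) (Dx1 d)) (fmul (Dx2 d) (Dx2 d)))
    (sper_fadd _ _ (sper_fmul _ _ H1 H1) (sper_fmul _ _ H2 H2))
    (fun x y => Rplus_le_le_0_compat _ _ (Rle_0_sqr _) (Rle_0_sqr _)) Id).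
  unfold fadd, fmul in Z.
  assert (Z1 : forall x y, Dx1 d x y = 0) by (intros x y; specialize (Z x y); nra).
  assert (Z2 : forall x y, Dx2 d x y = 0) by (intros x y; specialize (Z x y); nra).
  assert (E : forall x y, d x y = d 0 0).
  { intros x y; transitivity (d 0 y).
    - apply Rminus_diag_uniq.
      rewrite -(RInt_Derive (fun t => d t y)).
      + rewrite (RInt_ext _ (fun _ => 0)); [rewrite RInt_const; apply Rmult_0_r|].
        intros t _; apply Z1.
      + intros t _; apply smooth_ex_derive1, Hd.
      + intros t _; apply (continuous_ext (fun _ => 0)); [|apply continuous_const].
        intros s; symmetry; apply Z1.
    - apply Rminus_diag_uniq.
      rewrite -(RInt_Derive (fun t => d 0 t)).
      + rewrite (RInt_ext _ (fun _ => 0)); [rewrite RInt_const; apply Rmult_0_r|].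
        intros t _; apply Z2.
      + intros t _; apply smooth_ex_derive2, Hd.
      + intros t _; apply (continuous_ext (fun _ => 0)); [|apply continuous_const].
        intros s; symmetry; apply Z2. }
  assert (E' : d = fun _ _ => d 0 0) by (now apply fn_ext).
  unfold zero_mean in Md; rewrite E' intT_const in Md.
  assert (d 0 0 = 0).
  { assert (HPI := PI_RGT_0). assert (0 < PI ^ 2) by nra. nra. }
  rewrite E' H; reflexivity.
Qed.

(** * Trigonometric polynomials and the operator B *)

(** The free phase covers sines and cosines at once: differentiation shifts it by a quarter period,
    and a product of two waves is a sum of two waves. *)
Definition wave (c : R) (p q : Z) (phi : R) : fn :=
  fun x y => c * cos (IZR p * x + IZR q * y + phi).

Inductive trig : fn -> Prop :=
| trig_fzero : trig fzero
| trig_wave_fadd c p q phi f : trig f -> trig (fadd (wave c p q phi) f).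

Lemma trig_wave c p q phi : trig (wave c p q phi).
Proof.
  replace (wave c p q phi) with (fadd (wave c p q phi) fzero).
  - apply trig_wave_fadd, trig_fzero.
  - apply fn_ext; intros x y; apply Rplus_0_r.
Qed.

Lemma fadd_assoc f g h : fadd (fadd f g) h = fadd f (fadd g h).
Proof. apply fn_ext; intros x y; apply Rplus_assoc. Qed.

Lemma fadd_fzero_l f : fadd fzero f = f.
Proof. apply fn_ext; intros x y; apply Rplus_0_l. Qed.

Lemma trig_fadd f g : trig f -> trig g -> trig (fadd f g).
Proof.
  intros Hf Hg; induction Hf as [|c p q phi f Hf IH].
  - now rewrite fadd_fzero_l.
  - rewrite fadd_assoc; now apply trig_wave_fadd.
Qed.

Lemma trig_fscal a f : trig f -> trig (fscal a f).
Proof.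
  induction 1 as [|c p q phi f Hf IH].
  - replace (fscal a fzero) with fzero; [apply trig_fzero|].
    apply fn_ext; intros x y; symmetry; apply Rmult_0_r.
  - replace (fscal a (fadd (wave c p q phi) f))
      with (fadd (wave (a * c) p q phi) (fscal a f)); [now apply trig_wave_fadd|].
    apply fn_ext; intros x y; unfold fscal, fadd, wave; ring.
Qed.

Lemma wave_fmul c p q phi c' p' q' phi' :
  fmul (wave c p q phi) (wave c' p' q' phi') =
  fadd (wave (c * c' / 2) (p + p') (q + q') (phi + phi'))
       (wave (c * c' / 2) (p - p') (q - q') (phi - phi')).
Proof.
  apply fn_ext; intros x y; unfold fmul, fadd, wave.
  rewrite minus_IZR minus_IZR !plus_IZR.
  set (a := IZR p * x + IZR q * y + phi); set (b := IZR p' * x + IZR q' * y + phi').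
  replace (_ * x + _ * y + (phi + phi')) with (a + b) by (unfold a, b; ring).
  replace (_ * x + _ * y + (phi - phi')) with (a - b) by (unfold a, b; ring).
  rewrite cos_plus cos_minus; field.
Qed.

Lemma trig_fmul f g : trig f -> trig g -> trig (fmul f g).
Proof.
  intros Hf Hg; induction Hf as [|c p q phi f Hf IH].
  - replace (fmul fzero g) with fzero; [apply trig_fzero|].
    apply fn_ext; intros x y; symmetry; apply Rmult_0_l.
  - replace (fmul (fadd (wave c p q phi) f) g) with (fadd (fmul (wave c p q phi) g) (fmul f g))
      by (apply fn_ext; intros x y; unfold fmul, fadd; ring).
    apply trig_fadd; [|exact IH]; clear f Hf IH.
    induction Hg as [|c' p' q' phi' g Hg IH].
    + replace (fmul (wave c p q phi) fzero) with fzero; [apply trig_fzero|].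
      apply fn_ext; intros x y; symmetry; apply Rmult_0_r.
    + replace (fmul (wave c p q phi) (fadd (wave c' p' q' phi') g)) with
        (fadd (fmul (wave c p q phi) (wave c' p' q' phi')) (fmul (wave c p q phi) g))
        by (apply fn_ext; intros x y; unfold fmul, fadd; ring).
      rewrite wave_fmul; apply trig_fadd; [apply trig_fadd; apply trig_wave | exact IH].
Qed.

Lemma regular_wave c p q phi : regular (wave c p q phi).
Proof.
  split.
  - intros x y; unfold wave; split; auto_derive; trivial.
  - intros z; unfold wave.
    apply: continuous_mult; [apply continuous_const|].
    apply (continuous_comp (fun r : R * R => IZR p * fst r + IZR q * snd r + phi) cos);
      [|apply continuous_cos].
    apply: continuous_plus; [apply: continuous_plus|apply continuous_const];
      apply: continuous_mult; try apply continuous_const;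
      [apply continuous_fst | apply continuous_snd].
Qed.

Lemma Dx1_wave c p q phi : Dx1 (wave c p q phi) = wave (c * IZR p) p q (phi + PI / 2).
Proof.
  apply fn_ext; intros x y; unfold Dx1, wave; apply is_derive_unique.
  replace (IZR p * x + IZR q * y + (phi + PI / 2))
    with (PI / 2 + (IZR p * x + IZR q * y + phi)) by ring.
  rewrite -(Ropp_involutive (cos (PI / 2 + _))) -sin_cos.
  auto_derive; trivial; ring.
Qed.

Lemma Dx2_wave c p q phi : Dx2 (wave c p q phi) = wave (c * IZR q) p q (phi + PI / 2).
Proof.
  apply fn_ext; intros x y; unfold Dx2, wave; apply is_derive_unique.
  replace (IZR p * x + IZR q * y + (phi + PI / 2))
    with (PI / 2 + (IZR p * x + IZR q * y + phi)) by ring.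
  rewrite -(Ropp_involutive (cos (PI / 2 + _))) -sin_cos.
  auto_derive; trivial; ring.
Qed.

Lemma regular_trig f : trig f -> regular f.
Proof.
  induction 1 as [|c p q phi f Hf IH].
  - exact (smooth_regular _ (smooth_const 0)).
  - apply regular_fadd; [apply regular_wave | exact IH].
Qed.

Lemma trig_Dx1 f : trig f -> trig (Dx1 f).
Proof.
  induction 1 as [|c p q phi f Hf IH].
  - replace (Dx1 fzero) with fzero; [apply trig_fzero|].
    apply fn_ext; intros x y; symmetry; exact (Derive_const 0 x).
  - rewrite (Dx1_fadd _ _ (regular_wave _ _ _ _) (regular_trig _ Hf)) Dx1_wave.
    now apply trig_wave_fadd.
Qed.

Lemma trig_Dx2 f : trig f -> trig (Dx2 f).
Proof.
  induction 1 as [|c p q phi f Hf IH].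
  - replace (Dx2 fzero) with fzero; [apply trig_fzero|].
    apply fn_ext; intros x y; symmetry; exact (Derive_const 0 y).
  - rewrite (Dx2_fadd _ _ (regular_wave _ _ _ _) (regular_trig _ Hf)) Dx2_wave.
    now apply trig_wave_fadd.
Qed.

Lemma trig_smooth f : trig f -> smooth f.
Proof.
  apply smooth_coind; clear f; intros f Hf.
  split; [now apply regular_trig | split; [now apply trig_Dx1 | now apply trig_Dx2]].
Qed.

Lemma cos_period_Z x n : cos (x + 2 * IZR n * PI) = cos x.
Proof.
  destruct n as [|n|n].
  - f_equal; ring.
  - rewrite -(Znat.positive_nat_Z n) -INR_IZR_INZ; apply cos_period.
  - rewrite -(cos_period (x + 2 * IZR (Zneg n) * PI) (Pos.to_nat n)).
    f_equal; rewrite INR_IZR_INZ Znat.positive_nat_Z -[Zneg n]Pos2Z.opp_pos opp_IZR; ring.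
Qed.

Lemma trig_periodic f : trig f -> periodic f.
Proof.
  induction 1 as [|c p q phi f Hf IH].
  - exact (sper_periodic _ sper_fzero).
  - apply periodic_fadd; [|exact IH].
    intros x y; unfold wave; split; f_equal.
    + rewrite -(cos_period_Z (IZR p * x + IZR q * y + phi) p); f_equal; ring.
    + rewrite -(cos_period_Z (IZR p * x + IZR q * y + phi) q); f_equal; ring.
Qed.

Lemma trig_sper f : trig f -> sper f.
Proof. split; [now apply trig_smooth | now apply trig_periodic]. Qed.

Lemma trig_Lap f : trig f -> trig (Lap f).
Proof. intros; apply trig_fadd; [now apply trig_Dx1, trig_Dx1 | now apply trig_Dx2, trig_Dx2]. Qed.

Lemma Lap_fadd f g : sper f -> sper g -> Lap (fadd f g) = fadd (Lap f) (Lap g).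
Proof.
  intros; unfold Lap; rewrite !Dx1_fadd ?Dx2_fadd; auto with sper.
  apply fn_ext; intros x y; unfold fadd; ring.
Qed.

Lemma Lap_fscal c f : Lap (fscal c f) = fscal c (Lap f).
Proof.
  unfold Lap; rewrite !Dx1_fscal !Dx2_fscal.
  apply fn_ext; intros x y; unfold fadd, fscal; ring.
Qed.

Lemma Lap_wave c p q phi :
  Lap (wave c p q phi) = wave (- (IZR p ^ 2 + IZR q ^ 2) * c) p q phi.
Proof.
  unfold Lap; rewrite !Dx1_wave !Dx2_wave.
  apply fn_ext; intros x y; unfold fadd, wave.
  replace (IZR p * x + IZR q * y + (phi + PI / 2 + PI / 2))
    with (IZR p * x + IZR q * y + phi + PI) by field.
  rewrite neg_cos; ring.
Qed.

(** A wave of nonzero frequency is divided by its eigenvalue; waves of frequency zero are constants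
    and are absorbed in [c]. Leaving [c] free avoids reading the mean off a sum with repeated
    frequencies; symmetry removes it in [tlie_poisson]. *)
Lemma trig_poisson_mod_const F : trig F ->
  exists W c, trig W /\ Lap W = fadd F (fun _ _ => c).
Proof.
  induction 1 as [|c p q phi f Hf (W & c0 & HW & E)].
  - exists fzero, 0; split; [apply trig_fzero|].
    replace fzero with (fscal 0 fzero) at 1 by (apply fn_ext; intros x y; apply Rmult_0_l).
    rewrite Lap_fscal; apply fn_ext; intros x y; unfold fscal, fadd, fzero; ring.
  - destruct (Req_EM_T (IZR p ^ 2 + IZR q ^ 2) 0) as [Z|NZ].
    + exists W, (c0 - c * cos phi); split; [exact HW|].
      assert (Zp : IZR p = 0) by nra; assert (Zq : IZR q = 0) by nra.
      rewrite E; apply fn_ext; intros x y; unfold fadd, wave.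
      rewrite Zp Zq !Rmult_0_l !Rplus_0_l; ring.
    + exists (fadd (wave (- / (IZR p ^ 2 + IZR q ^ 2) * c) p q phi) W), c0.
      split; [now apply trig_wave_fadd|].
      rewrite Lap_fadd; [| apply trig_sper, trig_wave | now apply trig_sper].
      rewrite Lap_wave E; apply fn_ext; intros x y; unfold fadd, wave; field; exact NZ.
Qed.

(** * The symmetry I, Poisson's equation and the value of B *)

Definition reflI (f : fn) : fn := fun x y => f (2 * PI - x) (PI + y).

Lemma I_odd_reflI f : I_odd f <-> reflI f = fscal (-1) f.
Proof.
  split; intros H.
  - apply fn_ext; intros x y; unfold reflI, fscal; rewrite H; ring.
  - intros x y; change (reflI f x y = - f x y); rewrite H; unfold fscal; ring.
Qed.

Lemma trig_reflI f : trig f -> trig (reflI f).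
Proof.
  induction 1 as [|c p q phi f Hf IH].
  - apply trig_fzero.
  - replace (reflI (fadd (wave c p q phi) f)) with
      (fadd (wave c (- p) q (phi + IZR p * (2 * PI) + IZR q * PI)) (reflI f));
      [now apply trig_wave_fadd|].
    apply fn_ext; intros x y; unfold reflI, fadd, wave; rewrite opp_IZR.
    do 3 f_equal; ring.
Qed.

Lemma Dx1_reflI f : smooth f -> Dx1 (reflI f) = fscal (-1) (reflI (Dx1 f)).
Proof.
  intros Hf; apply fn_ext; intros x y; unfold Dx1, reflI, fscal.
  rewrite (Derive_comp (fun t => f t (PI + y)) (fun x => 2 * PI - x));
    [| now apply smooth_ex_derive1 | auto_derive; trivial].
  f_equal; apply is_derive_unique; auto_derive; trivial; ring.
Qed.

Lemma Dx2_reflI f : smooth f -> Dx2 (reflI f) = reflI (Dx2 f).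
Proof.
  intros Hf; apply fn_ext; intros x y; unfold Dx2, reflI.
  rewrite (Derive_comp (fun t => f (2 * PI - x) t) (fun y => PI + y));
    [| now apply smooth_ex_derive2 | auto_derive; trivial].
  rewrite (is_derive_unique (fun y => PI + y) y 1); [|auto_derive; trivial].
  apply Rmult_1_l.
Qed.

Lemma Lap_reflI f : smooth f -> Lap (reflI f) = reflI (Lap f).
Proof.
  intros Hf; unfold Lap.
  rewrite Dx1_reflI // Dx2_reflI // Dx1_fscal Dx1_reflI; auto using smooth_Dx1.
  rewrite Dx2_reflI; auto using smooth_Dx2.
  apply fn_ext; intros x y; unfold fadd, fscal, reflI; ring.
Qed.

Definition tlie (f : fn) : Prop := trig f /\ I_odd f.

Lemma tlie_sper f : tlie f -> sper f.
Proof. intros []; now apply trig_sper. Qed.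
#[global] Hint Resolve tlie_sper : sper.

Lemma tlie_fadd f g : tlie f -> tlie g -> tlie (fadd f g).
Proof.
  intros [Tf If] [Tg Ig]; split; [now apply trig_fadd|].
  intros x y; unfold fadd; rewrite If Ig; ring.
Qed.

Lemma tlie_fscal c f : tlie f -> tlie (fscal c f).
Proof.
  intros [Tf If]; split; [now apply trig_fscal|].
  intros x y; unfold fscal; rewrite If; ring.
Qed.

Lemma tlie_Lap f : tlie f -> tlie (Lap f).
Proof.
  intros [Tf If]; split; [now apply trig_Lap|].
  apply I_odd_reflI; rewrite -Lap_reflI; auto using trig_smooth.
  apply I_odd_reflI in If; now rewrite If Lap_fscal.
Qed.

(** I reverses the first coordinate only, so [Dx1] of an I-odd function is I-even while [Dx2] stays
    I-odd. Each term of the bracket thus has exactly one odd factor. *)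
Lemma tlie_br f g : tlie f -> tlie g -> tlie (br f g).
Proof.
  intros [Tf If] [Tg Ig]; split.
  - rewrite br_eq; apply trig_fadd; [|apply trig_fscal]; apply trig_fmul;
    auto using trig_Dx1, trig_Dx2.
  - assert (D1 : forall h, trig h -> I_odd h -> reflI (Dx1 h) = Dx1 h).
    { intros h Th Ih; apply I_odd_reflI in Ih.
      assert (E := Dx1_reflI h (trig_smooth _ Th)); rewrite Ih Dx1_fscal in E.
      apply fn_ext; intros x y.
      assert (E' := f_equal (fun k : fn => k x y) E); unfold fscal in E'; lra. }
    assert (D2 : forall h, trig h -> I_odd h -> reflI (Dx2 h) = fscal (-1) (Dx2 h)).
    { intros h Th Ih; apply I_odd_reflI in Ih.
      rewrite -(Dx2_reflI h (trig_smooth _ Th)) Ih; apply Dx2_fscal. }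
    intros x y; unfold br.
    change (reflI (Dx2 f) x y * reflI (Dx1 g) x y - reflI (Dx1 f) x y * reflI (Dx2 g) x y
      = - (Dx2 f x y * Dx1 g x y - Dx1 f x y * Dx2 g x y)).
    rewrite !D1 // !D2 //; unfold fscal; ring.
Qed.

(** Antisymmetrizing a solution modulo constants under [reflI] cancels the constant and keeps [F],
    which is I-odd. The result is I-odd because I applied twice is the translation by 2 pi in the
    second coordinate. *)
Lemma tlie_poisson F : tlie F -> exists W, tlie W /\ Lap W = F.
Proof.
  intros [TF IF]; destruct (trig_poisson_mod_const F TF) as (W & c & HW & E).
  assert (SW := trig_sper _ HW); assert (TW := trig_reflI _ HW).
  exists (fscal (1 / 2) (fadd W (fscal (-1) (reflI W)))); split; [split|].
  - apply trig_fscal, trig_fadd; [exact HW | now apply trig_fscal].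
  - intros x y; unfold fscal, fadd, reflI.
    assert (P := trig_periodic _ HW).
    replace (2 * PI - (2 * PI - x)) with x by ring.
    replace (PI + (PI + y)) with (y + 2 * PI) by ring.
    rewrite (proj2 (P x y)); ring.
  - rewrite Lap_fscal Lap_fadd; auto using trig_sper with sper.
    rewrite Lap_fscal Lap_reflI ?E; auto with sper.
    apply fn_ext; intros x y; unfold fscal, fadd, reflI; rewrite (IF x y); field.
Qed.

Lemma intT_Lap f : sper f -> intT (Lap f) = 0.
Proof.
  intros Hf; unfold Lap; rewrite intT_fadd; auto with sper.
  rewrite intT_Dx1 ?intT_Dx2; auto with sper; ring.
Qed.

(** The mean vanishes because [f] is itself a Laplacian. *)
Lemma tlie_lie f : tlie f -> lie f.
Proof.
  intros Hf; destruct (tlie_poisson f Hf) as (W & HW & E).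
  split; [|split; [|split]]; auto with sper; [|apply Hf].
  unfold zero_mean; rewrite -E; auto using intT_Lap with sper.
Qed.

Lemma lie_sper f : lie f -> sper f.
Proof. intros (H & H' & _); now split. Qed.
#[global] Hint Resolve lie_sper : sper.

Lemma lie_fsub f g : lie f -> lie g -> lie (fadd f (fscal (-1) g)).
Proof.
  intros Hf Hg.
  assert (Sf := lie_sper _ Hf); assert (Sg := lie_sper _ Hg).
  destruct Hf as (_ & _ & Mf & If), Hg as (_ & _ & Mg & Ig).
  unfold zero_mean in Mf, Mg.
  split; [|split; [|split]]; auto with sper.
  - unfold zero_mean; rewrite intT_fadd; auto with sper.
    rewrite intT_fscal ?Mf ?Mg; auto with sper; ring.
  - intros x y; unfold fadd, fscal; rewrite If Ig; ring.
Qed.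

Lemma fsub_eq0 f g : fadd f (fscal (-1) g) = fzero -> f = g.
Proof.
  intros E; apply fn_ext; intros x y.
  assert (E' := f_equal (fun k : fn => k x y) E).
  unfold fadd, fscal, fzero in E'; lra.
Qed.

Lemma lie_ip_inj f g : lie f -> lie g -> (forall w, lie w -> ip f w = ip g w) -> f = g.
Proof.
  intros Hf Hg H; apply fsub_eq0.
  set (d := fadd f (fscal (-1) g)).
  assert (Hd : lie d) by now apply lie_fsub.
  apply ip_definite; [now apply lie_sper | apply Hd |].
  assert (E := H d Hd).
  rewrite (ip_sym f) (ip_sym g) !ip_L2 in E; auto with sper.
  rewrite ip_L2; auto with sper.
  unfold d at 2; rewrite L2_fadd_r; auto with sper.
  rewrite L2_fscal_r; auto with sper; lra.
Qed.

(** Through this, identities between values of [Bop] are checked on their Laplacians, and no inverse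
    operator has to be defined. *)
Lemma Lap_inj f g : tlie f -> tlie g -> Lap f = Lap g -> f = g.
Proof.
  intros Hf Hg E; apply lie_ip_inj; try now apply tlie_lie.
  intros w Hw; rewrite !ip_L2 ?E; auto with sper.
Qed.

(** The solution [W] of Poisson's equation satisfies the defining property against every smooth test
    element, so the choice in [Bop] has a witness; definiteness on the whole Lie algebra then forces
    the chosen element to be [W], hence trigonometric. *)
Lemma Bop_spec f h : tlie f -> tlie h -> tlie (Bop f h) /\ Lap (Bop f h) = br (Lap f) h.
Proof.
  intros Hf Hh.
  destruct (tlie_poisson (br (Lap f) h)) as (W & HW & E).
  { apply tlie_br; [now apply tlie_Lap | exact Hh]. }
  assert (PW : lie W /\ forall w, lie w -> ip W w = ip f (br h w)).
  { split; [now apply tlie_lie|].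
    intros w Hw; rewrite !ip_L2 ?E ?L2_br_shift; auto 6 with sper. }
  assert (PB := epsilon_spec (inhabits fzero)
    (fun w0 => lie w0 /\ forall w, lie w -> ip w0 w = ip f (br h w)) (ex_intro _ W PW)).
  fold (Bop f h) in PB.
  replace (Bop f h) with W; [now split|].
  apply lie_ip_inj; [apply PW | apply PB|].
  intros w Hw; now rewrite (proj2 PW w Hw) (proj2 PB w Hw).
Qed.

(** * Curvature of a pair of eigenfunctions *)

Lemma br_fscal_l c f h : br (fscal c f) h = fscal c (br f h).
Proof.
  apply fn_ext; intros x y; unfold br; rewrite Dx1_fscal Dx2_fscal; unfold fscal; ring.
Qed.

Lemma br_diag f : br f f = fzero.
Proof. apply fn_ext; intros x y; unfold br, fzero; ring. Qed.

#[global] Hint Resolve tlie_fadd tlie_fscal tlie_Lap tlie_br : sper.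

Lemma tlie_Bop f h : tlie f -> tlie h -> tlie (Bop f h).
Proof. intros; now apply Bop_spec. Qed.
#[global] Hint Resolve tlie_Bop : sper.

Lemma nabla_eq f h :
  nabla f h = fscal (1 / 2) (fadd (br f h) (fscal (-1) (fadd (Bop f h) (Bop h f)))).
Proof. unfold nabla; now rewrite fopp_fscal. Qed.

Lemma tlie_nabla f h : tlie f -> tlie h -> tlie (nabla f h).
Proof. intros; rewrite nabla_eq; auto 7 with sper. Qed.
#[global] Hint Resolve tlie_nabla : sper.

Lemma ip_fadd_l f g h : sper f -> sper g -> sper h -> ip (fadd f g) h = ip f h + ip g h.
Proof.
  intros; rewrite !ip_L2 ?Lap_fadd ?L2_fadd_l; auto with sper; ring.
Qed.

Lemma ip_fscal_l c f h : sper f -> sper h -> ip (fscal c f) h = c * ip f h.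
Proof.
  intros; rewrite !ip_L2 ?Lap_fscal ?L2_fscal_l; auto with sper; ring.
Qed.

Lemma ip_Bop f h w : tlie f -> tlie h -> tlie w -> ip (Bop f h) w = ip f (br h w).
Proof.
  intros Hf Hh Hw; destruct (Bop_spec f h Hf Hh) as [HB E].
  rewrite !ip_L2 ?E ?L2_br_shift; auto 6 with sper.
Qed.

(** Koszul's formula: once paired with an element of the algebra, a covariant derivative involves
    brackets only. The outer derivatives of the curvature are evaluated this way. *)
Lemma ip_nabla f h w : tlie f -> tlie h -> tlie w ->
  ip (nabla f h) w = 1 / 2 * (ip (br f h) w - ip f (br h w) - ip h (br f w)).
Proof.
  intros; rewrite nabla_eq ip_fscal_l ?(ip_fadd_l (br f h)) ?(ip_fscal_l (-1)) ?(ip_fadd_l (Bop f h)) ?ip_Bop;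
    auto 7 with sper.
  ring.
Qed.

Lemma tlie_fzero : tlie fzero.
Proof. split; [apply trig_fzero|]; intros x y; unfold fzero; ring. Qed.
#[global] Hint Resolve tlie_fzero : sper.

Lemma fscal_0 f : fscal 0 f = fzero.
Proof. apply fn_ext; intros x y; apply Rmult_0_l. Qed.

Lemma fscal_fzero c : fscal c fzero = fzero.
Proof. apply fn_ext; intros x y; apply Rmult_0_r. Qed.

Lemma br_fzero_l f : br fzero f = fzero.
Proof. by rewrite -(fscal_0 f) br_fscal_l !fscal_0. Qed.

Lemma br_fzero_r f : br f fzero = fzero.
Proof. now rewrite br_antisym br_fzero_l fscal_fzero. Qed.

Lemma Lap_fzero : Lap fzero = fzero.
Proof. by rewrite -{1}(fscal_0 fzero) Lap_fscal fscal_0. Qed.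

Lemma L2_fzero_l f : L2 fzero f = 0.
Proof.
  unfold L2; replace (fmul fzero f) with (fun _ _ : R => 0).
  - rewrite intT_const; ring.
  - apply fn_ext; intros x y; unfold fmul, fzero; ring.
Qed.

Lemma ip_fzero_l f : sper f -> ip fzero f = 0.
Proof. intros; rewrite ip_L2 ?Lap_fzero ?L2_fzero_l; auto with sper; ring. Qed.

Lemma nabla_fzero_r f w : tlie f -> tlie w -> ip (nabla f fzero) w = 0.
Proof.
  intros; rewrite ip_nabla ?br_fzero_r ?br_fzero_l ?(ip_sym f) ?ip_fzero_l; auto with sper; ring.
Qed.

(** An eigenfunction is a stationary Euler flow: the Laplacian of [Bop u u] is a multiple of {u, u}
    = 0. This kills the term with two derivatives along [u] first and [v] second. *)
Lemma nabla_diag u K : tlie u -> Lap u = fscal (- K) u -> nabla u u = fzero.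
Proof.
  intros Hu Eu.
  rewrite nabla_eq br_diag.
  replace (Bop u u) with fzero.
  - apply fn_ext; intros x y; unfold fscal, fadd, fzero; ring.
  - apply Lap_inj; auto with sper.
    destruct (Bop_spec u u Hu Hu) as [_ ->].
    by rewrite Eu br_fscal_l br_diag Lap_fzero fscal_fzero.
Qed.

Lemma ip_Rcurv_eigen u v W K L : tlie u -> tlie v -> tlie W ->
  Lap u = fscal (- K) u -> Lap v = fscal (- L) v -> Lap W = br u v ->
  ip (Rcurv u v u) v =
    - (L - K) ^ 2 / 4 * L2 W (br u v) + (K + L) / 2 * L2 (br u v) (br u v)
    - 3 / 4 * ip (br u v) (br u v).
Proof.
  intros Hu Hv HW Eu Ev EW.
  remember (br u v) as g eqn:Dg; remember (nabla v u) as h eqn:Dh.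
  assert (Hg : tlie g) by (rewrite Dg; auto with sper).
  assert (Hh : tlie h) by (rewrite Dh; auto with sper).
  (* The only covariant derivative that has to be known explicitly. The Laplacian of B(u, v) + B(v,
     u) is - K {u, v} - L {v, u} = (L - K) g, whence the multiple of [W]. *)
  assert (Eh : h = fscal (1 / 2) (fadd (fscal (-1) g) (fscal (K - L) W))).
  { rewrite Dh nabla_eq (br_antisym v u) -Dg.
    replace (fadd (Bop v u) (Bop u v)) with (fscal (L - K) W).
    - apply fn_ext; intros x y; unfold fscal, fadd; ring.
    - apply Lap_inj; auto with sper.
      destruct (Bop_spec u v Hu Hv) as [HB EB]; destruct (Bop_spec v u Hv Hu) as [HB' EB'].
      rewrite Lap_fadd ?EB ?EB' ?Lap_fscal ?EW ?Eu ?Ev ?br_fscal_l ?(br_antisym v u) -?Dg;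
        auto with sper.
      apply fn_ext; intros x y; unfold fscal, fadd; ring. }
  assert (Ihg : ip h g = - 1 / 2 * ip g g + (L - K) / 2 * L2 g g).
  { rewrite Eh ip_fscal_l ?(ip_fadd_l (fscal (-1) g)) ?ip_fscal_l ?(ip_L2 W) ?EW; auto with sper.
    field. }
  assert (Lhg : L2 h g = - 1 / 2 * L2 g g - (L - K) / 2 * L2 W g).
  { rewrite Eh L2_fscal_l ?(L2_fadd_l (fscal (-1) g)) ?L2_fscal_l; auto with sper; field. }
  (* Against an eigenfunction the energy product is a multiple of the L2 product, where brackets can
     be shifted to produce [g]. *)
  assert (Euv : forall w, tlie w -> ip w v = L * L2 w v).
  { intros; rewrite ip_sym ip_L2 ?Ev ?L2_fscal_l ?(L2_sym w); auto with sper; ring. }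
  assert (Euu : forall w, tlie w -> ip u w = K * L2 w u).
  { intros; rewrite ip_L2 ?Eu ?L2_fscal_l ?(L2_sym w); auto with sper; ring. }
  assert (C1 : forall w, tlie w -> L2 (br w u) v = L2 w g).
  { intros; rewrite L2_br_shift -?Dg; auto with sper. }
  assert (C2 : forall w, tlie w -> L2 (br w v) u = - L2 w g).
  { intros; rewrite L2_br_shift ?(br_antisym v u) ?L2_fscal_r -?Dg; auto with sper.
    ring. }
  assert (N1 : ip (nabla u h) v =
    1 / 2 * (- L * L2 h g + K * L2 h g - ip h g)).
  { rewrite ip_nabla ?(Euv (br u h)) ?(Euu (br h v)) ?C2 ?(br_antisym u h) ?(L2_fscal_l (-1)) ?C1 -?Dg;
      auto with sper.
    ring. }
  assert (N2 : ip (nabla g u) v =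
    1 / 2 * (L * L2 g g - ip g g + K * L2 g g)).
  { rewrite ip_nabla ?(Euv (br g u)) ?(Euu (br g v)) ?C2 ?C1 -?Dg; auto with sper.
    ring. }
  unfold Rcurv; rewrite -Dg -Dh.
  rewrite (nabla_diag u K) // !fopp_fscal.
  rewrite ip_fadd_l ?(ip_fadd_l (fscal (-1) (nabla u h))) ?(ip_fscal_l (-1));
    auto 7 with sper.
  (* In the final sum the terms linear in L - K cancel; the coefficient - 3/4 is - 1/4 from the
     derivative of [h] plus - 1/2 from the derivative along [g]. *)
  assert (N0 := nabla_fzero_r v v Hv Hv).
  revert N0 N1 N2; generalize (ip (nabla u h) v) (ip (nabla g u) v) (ip (nabla v fzero) v).
  intros r1 r2 r0 -> -> ->; rewrite Ihg Lhg; field.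
Qed.

(** * Products of sines *)

Lemma RInt_cos_Z n phi :
  RInt (fun x => cos (IZR n * x + phi)) 0 (2 * PI) =
  if (n =? 0)%Z then 2 * PI * cos phi else 0.
Proof.
  destruct (Z.eqb_spec n 0) as [->|Hn].
  - rewrite (RInt_ext _ (fun _ => cos phi)).
    + rewrite RInt_const; unfold scal; simpl; unfold mult; simpl; ring.
    + intros x _; f_equal; ring.
  - assert (Hn' : IZR n <> 0) by now apply not_0_IZR.
    apply is_RInt_unique.
    evar_last.
    + apply (is_RInt_derive (fun x => / IZR n * cos (IZR n * x + (phi - PI / 2)))).
      * intros x _; auto_derive; trivial.
        replace (IZR n * x + (phi - PI / 2)) with (- (PI / 2 - (IZR n * x + phi))) by ring.
        rewrite sin_neg sin_shift; field; exact Hn'.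
      * intros x _; apply: ex_derive_continuous; auto_derive; trivial.
    + unfold minus, plus, opp; simpl.
      replace (IZR n * (2 * PI) + (phi - PI / 2))
        with (IZR n * 0 + (phi - PI / 2) + 2 * IZR n * PI) by ring.
      rewrite cos_period_Z; ring.
Qed.

(** Product modes separate the variables, so every L2 product on the torus factors into two of these
    integrals. *)
Definition gram (p : Z) (th : R) (q : Z) (ps : R) : R :=
  RInt (fun x => sin (IZR p * x + th) * sin (IZR q * x + ps)) 0 (2 * PI).

(** Frequencies p and - p span the same functions, hence the two resonances p = q and p = - q. *)
Lemma gram_eq p th q ps : gram p th q ps =
  (if (p - q =? 0)%Z then PI * cos (th - ps) else 0)
  - (if (p + q =? 0)%Z then PI * cos (th + ps) else 0).
Proof.
  unfold gram.
  rewrite (RInt_ext _ (fun x => plus (scal (1 / 2) (cos (IZR (p - q) * x + (th - ps))))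
                                     (scal (- 1 / 2) (cos (IZR (p + q) * x + (th + ps)))))).
  - assert (Ex : forall n phi a b, ex_RInt (fun x => cos (IZR n * x + phi)) a b).
    { intros; apply: ex_RInt_continuous; intros x _.
      apply: ex_derive_continuous; auto_derive; trivial. }
    rewrite RInt_plus; try (apply: ex_RInt_scal; apply Ex).
    rewrite !RInt_scal; try apply Ex.
    rewrite !RInt_cos_Z; unfold plus, scal; simpl; unfold mult; simpl.
    do 2 destruct Z.eqb; field.
  - intros x _; unfold plus, scal; simpl; unfold mult; simpl.
    rewrite minus_IZR plus_IZR.
    set (a := IZR p * x + th); set (b := IZR q * x + ps).
    replace (_ * x + (th - ps)) with (a - b) by (unfold a, b; ring).
    replace (_ * x + (th + ps)) with (a + b) by (unfold a, b; ring).
    rewrite cos_plus cos_minus; field.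
Qed.

Lemma intT_separable (f g : R -> R) :
  (forall x, continuous f x) -> (forall x, continuous g x) ->
  intT (fun x y => f x * g y) = RInt f 0 (2 * PI) * RInt g 0 (2 * PI).
Proof.
  intros Cf Cg; unfold intT.
  assert (Ef : ex_RInt f 0 (2 * PI)) by (apply: ex_RInt_continuous; auto).
  assert (Eg : ex_RInt g 0 (2 * PI)) by (apply: ex_RInt_continuous; auto).
  rewrite (RInt_ext _ (fun x => scal (RInt g 0 (2 * PI)) (f x))).
  - rewrite RInt_scal //; apply Rmult_comm.
  - intros x _; rewrite (RInt_ext _ (fun y => scal (f x) (g y))) //.
    rewrite RInt_scal //; apply Rmult_comm.
Qed.

(** The four exponentials of a mode factor into this form, see [mode_swave]. *)
Definition swave (c : R) (p q : Z) (th ps : R) : fn :=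
  fun x y => c * (sin (IZR p * x + th) * sin (IZR q * y + ps)).

Lemma swave_wave c p q th ps : swave c p q th ps =
  fadd (wave (c / 2) p (- q) (th - ps)) (wave (- c / 2) p q (th + ps)).
Proof.
  apply fn_ext; intros x y; unfold swave, fadd, wave; rewrite opp_IZR.
  set (a := IZR p * x + th); set (b := IZR q * y + ps).
  replace (_ * x + _ * y + (th - ps)) with (a - b) by (unfold a, b; ring).
  replace (_ * x + _ * y + (th + ps)) with (a + b) by (unfold a, b; ring).
  rewrite cos_plus cos_minus; field.
Qed.

Lemma trig_swave c p q th ps : trig (swave c p q th ps).
Proof. rewrite swave_wave; apply trig_fadd; apply trig_wave. Qed.

Lemma sper_swave c p q th ps : sper (swave c p q th ps).
Proof. apply trig_sper, trig_swave. Qed.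
#[global] Hint Resolve sper_swave : sper.

Definition sqn (p q : Z) : R := IZR p ^ 2 + IZR q ^ 2.

Lemma Lap_swave c p q th ps :
  Lap (swave c p q th ps) = swave (- sqn p q * c) p q th ps.
Proof.
  unfold sqn.
  rewrite !swave_wave Lap_fadd; try apply trig_sper, trig_wave.
  rewrite !Lap_wave opp_IZR; apply fn_ext; intros x y; unfold fadd, wave; field.
Qed.

Lemma L2_swave c p q th ps c' p' q' th' ps' :
  L2 (swave c p q th ps) (swave c' p' q' th' ps') =
  c * c' * (gram p th p' th' * gram q ps q' ps').
Proof.
  assert (C : forall p th p' th' x,
    continuous (fun x => sin (IZR p * x + th) * sin (IZR p' * x + th')) x).
  { intros; apply: ex_derive_continuous; auto_derive; trivial. }
  rewrite -[X in X * _]Rmult_1_l /gram -intT_separable //.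
  rewrite Rmult_1_l.
  set (F := fun x y : R => _ * _).
  transitivity (intT (fscal (c * c') F)).
  - unfold L2; f_equal; apply fn_ext; intros x y; unfold F, fmul, fscal, swave; ring.
  - apply intT_fscal.
    replace F with (fmul (swave 1 p q th ps) (swave 1 p' q' th' ps')); auto with sper.
    apply fn_ext; intros x y; unfold F, fmul, swave; ring.
Qed.


(* For [m = 1] and [c = A B / 4] this is the bracket of two product modes of amplitudes [A, B];
   a Fourier multiplier [m(-Delta)] weights its four components. *)
Definition brm (m : R -> R) (c : R) (k1 k2 l1 l2 : Z) (al ph be ps : R) : fn :=
  let d := IZR l1 * IZR k2 - IZR k1 * IZR l2 in
  let d' := IZR l1 * IZR k2 + IZR k1 * IZR l2 in
  fadd
    (fadd (swave (m (sqn (k1 + l1) (k2 + l2)) * (c * d)) (k1 + l1) (k2 + l2) (al + be) (ph + ps))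
          (swave (m (sqn (k1 - l1) (k2 - l2)) * (- c * d)) (k1 - l1) (k2 - l2) (al - be) (ph - ps)))
    (fadd (swave (m (sqn (k1 + l1) (k2 - l2)) * (- c * d')) (k1 + l1) (k2 - l2) (al + be) (ph - ps))
          (swave (m (sqn (k1 - l1) (k2 + l2)) * (c * d')) (k1 - l1) (k2 + l2) (al - be) (ph + ps))).

Lemma br_swave A B k1 k2 l1 l2 al ph be ps :
  br (swave A k1 k2 al ph) (swave B l1 l2 be ps) =
  brm (fun _ => 1) (A * B / 4) k1 k2 l1 l2 al ph be ps.
Proof.
  apply fn_ext; intros x y; unfold br.
  assert (D1 : forall c p q th ps, Dx1 (swave c p q th ps) x y =
    c * (IZR p * cos (IZR p * x + th) * sin (IZR q * y + ps))).
  { intros; unfold Dx1, swave; apply is_derive_unique; auto_derive; trivial; ring. }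
  assert (D2 : forall c p q th ps, Dx2 (swave c p q th ps) x y =
    c * (IZR q * sin (IZR p * x + th) * cos (IZR q * y + ps))).
  { intros; unfold Dx2, swave; apply is_derive_unique; auto_derive; trivial; ring. }
  rewrite !D1 !D2; unfold brm, fadd, swave.
  rewrite (minus_IZR k1) (minus_IZR k2) !plus_IZR.
  set (a := IZR k1 * x + al); set (b := IZR l1 * x + be).
  set (c := IZR k2 * y + ph); set (d := IZR l2 * y + ps).
  replace ((IZR k1 + IZR l1) * x + (al + be)) with (a + b) by (unfold a, b; ring).
  replace ((IZR k1 - IZR l1) * x + (al - be)) with (a - b) by (unfold a, b; ring).
  replace ((IZR k2 + IZR l2) * y + (ph + ps)) with (c + d) by (unfold c, d; ring).
  replace ((IZR k2 - IZR l2) * y + (ph - ps)) with (c - d) by (unfold c, d; ring).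
  rewrite !sin_minus !sin_plus; field.
Qed.

Lemma sper_brm m c k1 k2 l1 l2 al ph be ps : sper (brm m c k1 k2 l1 l2 al ph be ps).
Proof. unfold brm; auto with sper. Qed.
#[global] Hint Resolve sper_brm : sper.

Lemma Lap_brm m c k1 k2 l1 l2 al ph be ps :
  Lap (brm m c k1 k2 l1 l2 al ph be ps) = brm (fun r => - r * m r) c k1 k2 l1 l2 al ph be ps.
Proof.
  unfold brm; rewrite !Lap_fadd; auto with sper.
  rewrite !Lap_swave -!Rmult_assoc; reflexivity.
Qed.

(* In one variable, the phases of [sin (k x + al)] and [sin (l x + be)] when a zero frequency
   forces the constant function [1]; [n] is the resulting excess factor in the product of
   their square norms over [0, 2 pi]. *)
Definition axis (k : Z) (al : R) (l : Z) (be n : R) : Prop :=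
  (k <> l)%Z /\
  ((0 < k)%Z /\ (0 < l)%Z /\ n = 1 \/
   k = 0%Z /\ (0 < l)%Z /\ al = PI / 2 /\ n = 2 \/
   (0 < k)%Z /\ l = 0%Z /\ be = PI / 2 /\ n = 2).

Lemma gram_diag p th : p <> 0%Z -> gram p th p th = PI.
Proof.
  intros Hp; rewrite gram_eq Z.sub_diag Rminus_diag cos_0; simpl.
  destruct (Z.eqb_spec (p + p) 0); [lia | ring].
Qed.

Lemma gram_const : gram 0 (PI / 2) 0 (PI / 2) = 2 * PI.
Proof.
  rewrite gram_eq Rminus_diag cos_0; simpl.
  replace (PI / 2 + PI / 2) with PI by field; rewrite cos_PI; ring.
Qed.

Lemma gram_orth p th q ps : (p <> q -> p + q <> 0 -> gram p th q ps = 0%R)%Z.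
Proof.
  intros H H'; rewrite gram_eq.
  destruct (Z.eqb_spec (p - q) 0); [lia|].
  destruct (Z.eqb_spec (p + q) 0); [lia | ring].
Qed.

Lemma axis_norms k al l be n : axis k al l be n ->
  gram k al k al * gram l be l be = n * PI ^ 2.
Proof.
  intros (Hkl & [(Hk & Hl & ->) | [(-> & Hl & -> & ->) | (Hk & -> & -> & ->)]]);
    rewrite ?gram_const !gram_diag; try lia; ring.
Qed.

Lemma axis_orth k al l be n : axis k al l be n -> gram k al l be = 0.
Proof. intros (Hkl & H); apply gram_orth; destruct H as [|[]]; lia. Qed.

(** For positive k and l the frequencies k + l and k - l differ in absolute value. If k = 0, the sum
    and difference sines are the same function cos (l x + be); if l = 0, they are cos (k x + al) and
    its negative. This gives e = 0, 1, -1. *)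
Lemma axis_cross k al l be n : axis k al l be n ->
  exists e, gram (k + l) (al + be) (k - l) (al - be) = e * PI /\
            gram (k - l) (al - be) (k + l) (al + be) = e * PI /\
    (e = 0 /\ n = 1 \/ e = 1 /\ k = 0%Z /\ n = 2 \/ e = -1 /\ l = 0%Z /\ n = 2).
Proof.
  intros (Hkl & [(Hk & Hl & ->) | [(-> & Hl & -> & ->) | (Hk & -> & -> & ->)]]).
  - exists 0; rewrite !gram_orth; try lia; repeat split; try ring; now left.
  - exists 1; rewrite !gram_eq.
    replace (0 + l - (0 - l) =? 0)%Z with false by (symmetry; apply Z.eqb_neq; lia).
    replace (0 - l - (0 + l) =? 0)%Z with false by (symmetry; apply Z.eqb_neq; lia).
    replace (0 + l + (0 - l) =? 0)%Z with true by (symmetry; apply Z.eqb_eq; lia).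
    replace (0 - l + (0 + l) =? 0)%Z with true by (symmetry; apply Z.eqb_eq; lia).
    replace (PI / 2 + be + (PI / 2 - be)) with PI by field.
    replace (PI / 2 - be + (PI / 2 + be)) with PI by field.
    rewrite cos_PI; repeat split; try ring; auto.
  - exists (-1); rewrite !gram_eq.
    replace (k + 0 - (k - 0) =? 0)%Z with true by (symmetry; apply Z.eqb_eq; lia).
    replace (k - 0 - (k + 0) =? 0)%Z with true by (symmetry; apply Z.eqb_eq; lia).
    replace (k + 0 + (k - 0) =? 0)%Z with false by (symmetry; apply Z.eqb_neq; lia).
    replace (k - 0 + (k + 0) =? 0)%Z with false by (symmetry; apply Z.eqb_neq; lia).
    replace (al + PI / 2 - (al - PI / 2)) with PI by field.
    replace (al - PI / 2 - (al + PI / 2)) with (- PI) by field.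
    rewrite cos_neg cos_PI; repeat split; try ring; auto.
Qed.

(** Without zero frequencies the four components are orthogonal. On a degenerate axis components
    coincide in pairs with equal multipliers; their amplitudes agree up to the sign e, so they
    reinforce, and the cross terms account for the factor 2 in [n1] or [n2]. *)
Lemma L2_brm m m' c k1 k2 l1 l2 al ph be ps n1 n2 :
  axis k1 al l1 be n1 -> axis k2 ph l2 ps n2 ->
  L2 (brm m c k1 k2 l1 l2 al ph be ps) (brm m' c k1 k2 l1 l2 al ph be ps) =
  n1 * n2 * PI ^ 2 * c ^ 2 *
    ((IZR l1 * IZR k2 - IZR k1 * IZR l2) ^ 2 *
       (m (sqn (k1 + l1) (k2 + l2)) * m' (sqn (k1 + l1) (k2 + l2))
        + m (sqn (k1 - l1) (k2 - l2)) * m' (sqn (k1 - l1) (k2 - l2)))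
     + (IZR l1 * IZR k2 + IZR k1 * IZR l2) ^ 2 *
       (m (sqn (k1 + l1) (k2 - l2)) * m' (sqn (k1 + l1) (k2 - l2))
        + m (sqn (k1 - l1) (k2 + l2)) * m' (sqn (k1 - l1) (k2 + l2)))).
Proof.
  intros H1 H2.
  unfold brm; rewrite !L2_fadd_l ?L2_fadd_r; auto with sper.
  rewrite !L2_swave.
  (* Components with a nonzero mutual product have the same frequency up to signs, hence the same
     values of the multipliers. *)
  assert (Sn : forall p q r s, (p = r \/ p = - r)%Z -> (q = s \/ q = - s)%Z ->
    sqn p q = sqn r s).
  { intros p q r s [->| ->] [->| ->]; unfold sqn; rewrite ?opp_IZR; ring. }
  destruct (axis_cross _ _ _ _ _ H1) as (e1 & -> & -> & C1).
  destruct (axis_cross _ _ _ _ _ H2) as (e2 & -> & -> & C2).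
  destruct H1 as [N1 H1], H2 as [N2 H2].
  rewrite !gram_diag; try (destruct H1 as [|[]]; lia); try (destruct H2 as [|[]]; lia).
  clear H1 H2.
  destruct C1 as [(-> & ->)|C1];
    [|assert (S1 : forall q, sqn (k1 - l1) q = sqn (k1 + l1) q) by (intros q; apply Sn; lia);
      rewrite !S1; clear S1; destruct C1 as [(-> & -> & ->)|(-> & -> & ->)]];
  (destruct C2 as [(-> & ->)|C2];
    [|assert (S2 : forall p, sqn p (k2 - l2) = sqn p (k2 + l2)) by (intros p; apply Sn; lia);
      rewrite !S2; clear S2; destruct C2 as [(-> & -> & ->)|(-> & -> & ->)]]);
  ring.
Qed.

(** * The exact curvature of two product modes *)

Lemma axis_pos k al l be n : axis k al l be n -> 0 < n.
Proof. intros (_ & [(_ & _ & ->)|[(_ & _ & _ & ->)|(_ & _ & _ & ->)]]); lra. Qed.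

Lemma sqn_pos p q : p <> 0%Z -> 0 < sqn p q.
Proof.
  intros H; unfold sqn.
  assert (IZR p <> 0) by now apply not_0_IZR.
  assert (0 < IZR p ^ 2) by (rewrite -Rsqr_pow2; now apply Rsqr_pos_lt).
  assert (0 <= IZR q ^ 2) by apply pow2_ge_0. lra.
Qed.

Lemma sec_curv_swave A B k1 k2 l1 l2 al ph be ps n1 n2 :
  let u := swave A k1 k2 al ph in
  let v := swave B l1 l2 be ps in
  A <> 0 -> B <> 0 -> I_odd u -> I_odd v ->
  axis k1 al l1 be n1 -> axis k2 ph l2 ps n2 ->
  0 < sqn k1 k2 -> 0 < sqn l1 l2 ->
  let s := sqn k1 k2 + sqn l1 l2 in
  let x := IZR k1 * IZR l1 + IZR k2 * IZR l2 in
  let x' := IZR k1 * IZR l1 - IZR k2 * IZR l2 in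
  sec_curv u v =
    - / (8 * PI ^ 2) * s / (sqn k1 k2 * sqn l1 l2) *
    ((IZR l1 * IZR k2 - IZR k1 * IZR l2) ^ 4 / (s ^ 2 - 4 * x ^ 2) +
     (IZR l1 * IZR k2 + IZR k1 * IZR l2) ^ 4 / (s ^ 2 - 4 * x' ^ 2)).
Proof.
  intros u v HA HB Iu Iv X1 X2 HK HL s x x'.
  assert (Hu : tlie u) by (split; [apply trig_swave | exact Iu]).
  assert (Hv : tlie v) by (split; [apply trig_swave | exact Iv]).
  destruct (tlie_poisson (br u v) (tlie_br _ _ Hu Hv)) as (W & HW & EW).
  assert (Eu : Lap u = fscal (- sqn k1 k2) u).
  { unfold u; rewrite Lap_swave; apply fn_ext; intros; unfold fscal, swave; ring. }
  assert (Ev : Lap v = fscal (- sqn l1 l2) v).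
  { unfold v; rewrite Lap_swave; apply fn_ext; intros; unfold fscal, swave; ring. }
  (* The first coordinate alone suffices: k1 and l1 are nonnegative and distinct, so neither their
     sum nor their difference is 0. *)
  assert (Q1 : 0 < sqn (k1 + l1) (k2 + l2)) by (apply sqn_pos; destruct X1 as [? [|[]]]; lia).
  assert (Q2 : 0 < sqn (k1 - l1) (k2 - l2)) by (apply sqn_pos; destruct X1 as [? [|[]]]; lia).
  assert (Q3 : 0 < sqn (k1 + l1) (k2 - l2)) by (apply sqn_pos; destruct X1 as [? [|[]]]; lia).
  assert (Q4 : 0 < sqn (k1 - l1) (k2 + l2)) by (apply sqn_pos; destruct X1 as [? [|[]]]; lia).
  assert (Su := tlie_sper _ Hu); assert (Sv := tlie_sper _ Hv).
  assert (Euu : ip u u = sqn k1 k2 * (A ^ 2 * (gram k1 al k1 al * gram k2 ph k2 ph))).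
  { rewrite ip_L2 // Eu (L2_fscal_l _ u u) // /u L2_swave; ring. }
  assert (Evv : ip v v = sqn l1 l2 * (B ^ 2 * (gram l1 be l1 be * gram l2 ps l2 ps))).
  { rewrite ip_L2 // Ev (L2_fscal_l _ v v) // /v L2_swave; ring. }
  assert (Euv : ip u v = 0).
  { rewrite ip_L2 // Eu (L2_fscal_l _ u v) // /u /v L2_swave (axis_orth _ _ _ _ _ X1); ring. }
  set (P m := brm m (A * B / 4) k1 k2 l1 l2 al ph be ps).
  assert (Eg : br u v = P (fun _ => 1)) by apply br_swave.
  assert (EP : Lap (P (fun r => - / r)) = P (fun _ => 1)).
  { unfold P; rewrite Lap_brm; unfold brm.
    assert (I : forall r, 0 < r -> - r * - / r = 1) by (intros r Hr; field; lra).
    now rewrite !I. }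
  assert (EWg : L2 W (br u v) = L2 (P (fun _ => 1)) (P (fun r => - / r))).
  { rewrite Eg -EP -Lap_sym; [now rewrite EW Eg EP | now apply tlie_sper | apply sper_brm]. }
  assert (Egg : ip (br u v) (br u v) = - L2 (P (fun r => - r * 1)) (P (fun _ => 1))).
  { rewrite ip_L2; auto with sper. rewrite Eg; unfold P at 1; now rewrite Lap_brm. }
  unfold sec_curv; rewrite (ip_Rcurv_eigen u v W _ _ Hu Hv HW Eu Ev EW).
  rewrite EWg Egg Eg; unfold P; rewrite !(L2_brm _ _ _ _ _ _ _ _ _ _ _ n1 n2) //.
  replace (ip u u * ip v v - ip u v ^ 2) with
    (sqn k1 k2 * sqn l1 l2 * A ^ 2 * B ^ 2 * (n1 * PI ^ 2) * (n2 * PI ^ 2)).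
  2: { rewrite Euu Evv Euv -(axis_norms _ _ _ _ _ X1) -(axis_norms _ _ _ _ _ X2); ring. }
  assert (N1 := axis_pos _ _ _ _ _ X1); assert (N2 := axis_pos _ _ _ _ _ X2).
  assert (HPI := PI_RGT_0).
  assert (E1 : sqn (k1 + l1) (k2 + l2) = s + 2 * x) by (unfold s, x, sqn; rewrite !plus_IZR; ring).
  assert (E2 : sqn (k1 - l1) (k2 - l2) = s - 2 * x)
    by (unfold s, x, sqn; rewrite (minus_IZR k1) (minus_IZR k2); ring).
  assert (E3 : sqn (k1 + l1) (k2 - l2) = s + 2 * x')
    by (unfold s, x', sqn; rewrite (minus_IZR k2) plus_IZR; ring).
  assert (E4 : sqn (k1 - l1) (k2 + l2) = s - 2 * x')
    by (unfold s, x', sqn; rewrite (minus_IZR k1) plus_IZR; ring).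
  rewrite E1 in Q1 |- *; rewrite E2 in Q2 |- *; rewrite E3 in Q3 |- *; rewrite E4 in Q4 |- *.
  set (d := IZR l1 * IZR k2 - IZR k1 * IZR l2); set (d' := IZR l1 * IZR k2 + IZR k1 * IZR l2).
  (* Lagrange's identity eliminates the determinants, leaving a rational identity in K, L, x and
     x'. *)
  assert (Dd : d ^ 2 = sqn k1 k2 * sqn l1 l2 - x ^ 2) by (unfold d, x, sqn; ring).
  assert (Dd' : d' ^ 2 = sqn k1 k2 * sqn l1 l2 - x' ^ 2) by (unfold d', x', sqn; ring).
  replace (d ^ 4) with ((d ^ 2) ^ 2) by ring; replace (d' ^ 4) with ((d' ^ 2) ^ 2) by ring.
  rewrite Dd Dd'.
  unfold s in *; clearbody x x'; clear - HK HL HA HB N1 N2 HPI Q1 Q2 Q3 Q4.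
  revert HK HL Q1 Q2 Q3 Q4; generalize (sqn k1 k2) (sqn l1 l2); intros K L HK HL Q1 Q2 Q3 Q4.
  assert (R1 : (K + L) ^ 2 - 4 * x ^ 2 <> 0).
  { replace (_ - _) with ((K + L + 2 * x) * (K + L - 2 * x)) by ring. nra. }
  assert (R2 : (K + L) ^ 2 - 4 * x' ^ 2 <> 0).
  { replace (_ - _) with ((K + L + 2 * x') * (K + L - 2 * x')) by ring. nra. }
  field; repeat split; trivial; lra.
Qed.

(** * The asymptotics *)

(** The sign in the mode is the parity of its second index: it pairs the exponentials into a cosine
    in the first variable for odd index and, below, into a sine for even index. *)
Lemma mode_odd p q k1 n x y :
  mode (p, q) (k1, S (2 * n)) x y =
  4 * cos (INR k1 * x) * (p * cos (INR (S (2 * n)) * y) - q * sin (INR (S (2 * n)) * y)).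
Proof.
  unfold mode; cbv beta zeta; cbn [fst snd].
  replace (S (2 * n) + 1)%nat with (2 * S n)%nat by lia; rewrite pow_1_even.
  set (k2 := INR (S (2 * n))); unfold ek, Re, Cconj, RtoC, Cplus, Cmult; cbn [fst snd].
  rewrite -!(Ropp_mult_distr_l (INR k1)) -!(Ropp_mult_distr_l k2) !cos_plus !sin_plus !cos_neg !sin_neg; ring.
Qed.

Lemma mode_even p q k1 n x y :
  mode (p, q) (k1, 2 * n)%nat x y =
  - 4 * sin (INR k1 * x) * (p * sin (INR (2 * n) * y) + q * cos (INR (2 * n) * y)).
Proof.
  unfold mode; cbv beta zeta; cbn [fst snd].
  replace (2 * n + 1)%nat with (S (2 * n))%nat by lia; rewrite pow_1_odd.
  set (k2 := INR (2 * n)); unfold ek, Re, Cconj, RtoC, Cplus, Cmult; cbn [fst snd].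
  rewrite -!(Ropp_mult_distr_l (INR k1)) -!(Ropp_mult_distr_l k2) !cos_plus !sin_plus !cos_neg !sin_neg; ring.
Qed.

(** The amplitude may be negative, so [atan] needs no choice of quadrant. At frequency 0 the phase
    pi / 2 makes the sine the constant 1, as [axis] requires. *)
Lemma sinusoid_polar p q (k : nat) : exists r ph,
  (k = 0%nat -> ph = PI / 2) /\
  forall y, p * sin (INR k * y) + q * cos (INR k * y) = r * sin (INR k * y + ph).
Proof.
  destruct (Nat.eq_dec k 0) as [->|Hk].
  - exists q, (PI / 2); split; trivial; intros y; simpl.
    rewrite !Rmult_0_l Rplus_0_l sin_0 cos_0 sin_PI2; ring.
  - destruct (Req_dec p 0) as [->|Hp].
    + exists q, (PI / 2); split; [lia|]; intros y.
      rewrite sin_plus sin_PI2 cos_PI2; ring.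
    + assert (C := cos_atan (q / p)); assert (S := sin_atan (q / p)).
      assert (0 < sqrt (1 + (q / p)²)).
      { apply sqrt_lt_R0; assert (H := Rle_0_sqr (q / p)); lra. }
      exists (p * sqrt (1 + (q / p)²)), (atan (q / p)); split; [lia|]; intros y.
      rewrite sin_plus C S; field; split; trivial; lra.
Qed.

Lemma I_odd_mode a k : I_odd (mode a k).
Proof.
  destruct a as [p q], k as [k1 k2]; intros x y.
  assert (X : INR k1 * (2 * PI - x) = - (INR k1 * x) + 2 * INR k1 * PI) by ring.
  destruct (Nat.Even_or_Odd k2) as [[n ->]|[n ->]].
  - rewrite !mode_even X sin_period sin_neg.
    replace (INR (2 * n) * (PI + y)) with (INR (2 * n) * y + 2 * INR n * PI)
      by (rewrite mult_INR; simpl; ring).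
    rewrite sin_period cos_period; ring.
  - rewrite Nat.add_1_r !mode_odd X cos_period cos_neg.
    replace (INR (S (2 * n)) * (PI + y)) with (INR (S (2 * n)) * y + PI + 2 * INR n * PI)
      by (rewrite S_INR mult_INR; simpl; ring).
    rewrite sin_period cos_period neg_sin neg_cos; ring.
Qed.

Lemma mode_swave a k : mode a k <> fzero ->
  exists A al ph,
    mode a k = swave A (Z.of_nat (fst k)) (Z.of_nat (snd k)) al ph /\ A <> 0 /\
    (fst k = 0%nat -> al = PI / 2) /\ (snd k = 0%nat -> ph = PI / 2) /\ k <> (0%nat, 0%nat).
Proof.
  destruct a as [p q], k as [k1 k2]; cbn [fst snd]; intros H.
  assert (G : exists A al ph, mode (p, q) (k1, k2) = swave A (Z.of_nat k1) (Z.of_nat k2) al ph /\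
    (k1 = 0%nat -> al = PI / 2) /\ (k2 = 0%nat -> ph = PI / 2) /\ (k1, k2) <> (0%nat, 0%nat)).
  { destruct (Nat.Even_or_Odd k2) as [[n ->]|[n ->]].
    (* For even second index the factor sin (k1 x) would vanish at k1 = 0. So a nonzero mode with k1
       = 0 has odd second index, and its cosine gives the phase pi / 2. *)
    - assert (Hk1 : k1 <> 0%nat).
      { intros ->; apply H, fn_ext; intros x y; rewrite mode_even; unfold fzero; simpl.
        rewrite !Rmult_0_l sin_0; ring. }
      destruct (sinusoid_polar p q (2 * n)) as (r & ph & Hph & E).
      exists (- 4 * r), 0, ph; split; [|split; [lia | split; [exact Hph | congruence]]].
      apply fn_ext; intros x y; unfold swave; rewrite mode_even E -!INR_IZR_INZ Rplus_0_r; ring.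
    - destruct (sinusoid_polar (- q) p (2 * n + 1)) as (r & ph & Hph & E).
      rewrite Nat.add_1_r in E Hph |- *.
      exists (4 * r), (PI / 2), ph; split; [|split; [easy | split; [exact Hph | congruence]]].
      apply fn_ext; intros x y; unfold swave; rewrite mode_odd -!INR_IZR_INZ.
      rewrite (sin_plus (INR k1 * x)) cos_PI2 sin_PI2.
      rewrite -(Rmult_comm (sin (_ + ph))) Rmult_assoc.
      replace (_ - _) with (r * sin (INR (S (2 * n)) * y + ph)) by (rewrite -E; ring); ring. }
  destruct G as (A & al & ph & E & G); exists A, al, ph; split; [exact E|]; split; [|exact G].
  intros ->; apply H; rewrite E; apply fn_ext; intros x y; apply Rmult_0_l.
Qed.

Lemma axis_of_nat (k l : nat) al be : k <> l ->
  (k = 0%nat -> al = PI / 2) -> (l = 0%nat -> be = PI / 2) ->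
  exists n, axis (Z.of_nat k) al (Z.of_nat l) be n.
Proof.
  intros Hkl Ha Hb; unfold axis.
  destruct (Nat.eq_dec k 0) as [->|Hk]; [|destruct (Nat.eq_dec l 0) as [->|Hl]].
  - exists 2; split; [lia|]; right; left; repeat split; auto; lia.
  - exists 2; split; [lia|]; right; right; repeat split; auto; lia.
  - exists 1; split; [lia|]; left; repeat split; lia.
Qed.

Lemma sqn_of_nat (k1 k2 : nat) : sqn (Z.of_nat k1) (Z.of_nat k2) = INR k1 ^ 2 + INR k2 ^ 2.
Proof. unfold sqn; now rewrite -!INR_IZR_INZ. Qed.

Lemma sqnorm_pos (k : nat * nat) : k <> (0%nat, 0%nat) -> 0 < INR (fst k) ^ 2 + INR (snd k) ^ 2.
Proof.
  destruct k as [k1 k2]; cbn [fst snd]; intros H.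
  rewrite -sqn_of_nat.
  destruct (Nat.eq_dec k1 0) as [E|Hk].
  - unfold sqn; rewrite Rplus_comm; apply sqn_pos; intros E'; apply H; f_equal; lia.
  - apply sqn_pos; lia.
Qed.

Lemma sec_curv_mode a k b l :
  mode a k <> fzero -> mode b l <> fzero -> fst l <> fst k -> snd l <> snd k ->
  let k1 := INR (fst k) in let k2 := INR (snd k) in
  let l1 := INR (fst l) in let l2 := INR (snd l) in
  let K := k1 ^ 2 + k2 ^ 2 in let L := l1 ^ 2 + l2 ^ 2 in
  sec_curv (mode a k) (mode b l) =
    - / (8 * PI ^ 2) * (K + L) / (K * L) *
    ((l1 * k2 - k1 * l2) ^ 4 / ((K + L) ^ 2 - 4 * (k1 * l1 + k2 * l2) ^ 2) +
     (l1 * k2 + k1 * l2) ^ 4 / ((K + L) ^ 2 - 4 * (k1 * l1 - k2 * l2) ^ 2)).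
Proof.
  intros Hk Hl H1 H2 k1 k2 l1 l2 K L.
  assert (Ik := I_odd_mode a k); assert (Il := I_odd_mode b l).
  destruct (mode_swave a k Hk) as (A & al & ph & Ek & HA & Ha & Hp & Zk).
  destruct (mode_swave b l Hl) as (B & be & ps & El & HB & Hb & Hs & Zl).
  rewrite Ek in Ik |- *; rewrite El in Il |- *.
  destruct (axis_of_nat _ _ al be (not_eq_sym H1) Ha Hb) as (n1 & X1).
  destruct (axis_of_nat _ _ ph ps (not_eq_sym H2) Hp Hs) as (n2 & X2).
  rewrite (sec_curv_swave _ _ _ _ _ _ _ _ _ _ n1 n2 HA HB Ik Il X1 X2);
    rewrite ?sqn_of_nat -?INR_IZR_INZ; auto using sqnorm_pos.
Qed.

(** * Passage to the limit *)

Lemma cos_sin_ang x y : 0 <= x -> 0 <= y -> 0 < x ^ 2 + y ^ 2 ->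
  cos (ang x y) = x / sqrt (x ^ 2 + y ^ 2) /\ sin (ang x y) = y / sqrt (x ^ 2 + y ^ 2).
Proof.
  intros Hx Hy H; unfold ang.
  destruct (Req_EM_T x 0) as [->|Nx].
  - rewrite cos_PI2 sin_PI2.
    replace (0 ^ 2 + y ^ 2) with (y ^ 2) in * by ring.
    rewrite sqrt_pow2 //.
    assert (y <> 0) by nra.
    split; field; trivial.
  - rewrite cos_atan sin_atan.
    replace (1 + (y / x)²) with ((x ^ 2 + y ^ 2) / x ^ 2) by (unfold Rsqr; field; trivial).
    assert (0 < x ^ 2) by nra.
    rewrite sqrt_div_alt // sqrt_pow2 //.
    assert (0 < sqrt (x ^ 2 + y ^ 2)) by now apply sqrt_lt_R0.
    split; field; split; trivial; lra.
Qed.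

(** The expression is the product of the squared norms of the sum and the difference of (x, y) and
    (z, w), whose first coordinates are nonzero. *)
Lemma curv_denominator_pos x y z w : 0 <= x -> 0 <= z -> x <> z ->
  0 < (x ^ 2 + y ^ 2 + (z ^ 2 + w ^ 2)) ^ 2 - 4 * (x * z + y * w) ^ 2.
Proof.
  intros Hx Hz H.
  replace (_ - _) with (((x + z) ^ 2 + (y + w) ^ 2) * ((x - z) ^ 2 + (y - w) ^ 2)) by ring.
  assert (P : forall u v, u <> 0 -> 0 < u ^ 2 + v ^ 2).
  { intros u v Hu; assert (0 < u ^ 2) by (rewrite -Rsqr_pow2; now apply Rsqr_pos_lt).
    assert (0 <= v ^ 2) by apply pow2_ge_0; lra. }
  apply Rmult_lt_0_compat; apply P; lra.
Qed.

Theorem theorem4 (k : nat * nat) (a : C)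
  (l : nat -> nat * nat) (b : nat -> C) (lv : R * R) :
  k <> (0%nat, 0%nat) ->
  mode a k <> fzero ->
  (forall m, fst (l m) <> fst k) ->
  (forall m, snd (l m) <> snd k) ->
  is_lim_seq (fun m => sqrt (INR (fst (l m)) ^ 2 + INR (snd (l m)) ^ 2)) p_infty ->
  is_lim_seq (fun m => INR (fst (l m)) / sqrt (INR (fst (l m)) ^ 2 + INR (snd (l m)) ^ 2))
    (fst lv) ->
  is_lim_seq (fun m => INR (snd (l m)) / sqrt (INR (fst (l m)) ^ 2 + INR (snd (l m)) ^ 2))
    (snd lv) ->
  (forall m, mode (b m) (l m) <> fzero) ->
  let kappa := ang (INR (fst k)) (INR (snd k)) in
  let lambda := ang (fst lv) (snd lv) in
  is_lim_seq (fun m => sec_curv (mode a k) (mode (b m) (l m)))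
    (- ((INR (fst k)) ^ 2 + (INR (snd k)) ^ 2) / (2 * S_T)
       * (sin (lambda - kappa) ^ 4 + sin (lambda + kappa) ^ 4)).
Proof.
  destruct lv as [p q].
  intros Zk Hk H1 H2 Lr Lp Lq Hl kappa lambda.
  cbn [fst snd] in Lp, Lq, lambda.
  set (k1 := INR (fst k)) in *; set (k2 := INR (snd k)) in *; set (K := k1 ^ 2 + k2 ^ 2).
  assert (HK : 0 < K) by now apply sqnorm_pos.
  set (r := fun m => sqrt (INR (fst (l m)) ^ 2 + INR (snd (l m)) ^ 2)) in *.
  set (y1 := fun m => INR (fst (l m)) / r m); set (y2 := fun m => INR (snd (l m)) / r m).
  change (is_lim_seq y1 p) in Lp; change (is_lim_seq y2 q) in Lq.
  assert (Lpos : forall m, 0 < INR (fst (l m)) ^ 2 + INR (snd (l m)) ^ 2).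
  { intros m; apply sqnorm_pos; now destruct (mode_swave _ _ (Hl m)) as (? & ? & ? & ? & ? & ? & ? & Z). }
  assert (Hr : forall m, 0 < r m) by (intros m; now apply sqrt_lt_R0).
  assert (Er : forall m, r m ^ 2 = INR (fst (l m)) ^ 2 + INR (snd (l m)) ^ 2).
  { intros m; unfold r; rewrite pow2_sqrt //; apply Rlt_le, Lpos. }
  assert (Ey : forall m, y1 m ^ 2 + y2 m ^ 2 = 1).
  { intros m; unfold y1, y2.
    replace (_ + _) with ((INR (fst (l m)) ^ 2 + INR (snd (l m)) ^ 2) / r m ^ 2)
      by (field; apply Rgt_not_eq, Hr).
    rewrite -Er; field; apply Rgt_not_eq, Hr. }
  assert (Sq : forall u (c : R), is_lim_seq u c -> forall n, is_lim_seq (fun m => u m ^ n) (c ^ n)).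
  { intros u c Hu n; induction n as [|n IH]; simpl; [apply is_lim_seq_const|].
    now apply is_lim_seq_mult'. }
  assert (Pos : forall u (c : R), (forall m, 0 <= u m) -> is_lim_seq u c -> 0 <= c).
  { intros u c Hu Lu; exact (is_lim_seq_le (fun _ => 0) u 0 c Hu (is_lim_seq_const 0) Lu). }
  assert (Hp : 0 <= p).
  { apply (Pos y1) => // m; apply Rdiv_le_0_compat; [apply pos_INR | apply Hr]. }
  assert (Hq : 0 <= q).
  { apply (Pos y2) => // m; apply Rdiv_le_0_compat; [apply pos_INR | apply Hr]. }
  (* The limit direction is again a unit vector, hence the cosine and sine of lambda. *)
  assert (Hpq : p ^ 2 + q ^ 2 = 1).
  { assert (E := is_lim_seq_plus' _ _ _ _ (Sq _ _ Lp 2%nat) (Sq _ _ Lq 2%nat)).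
    apply (is_lim_seq_ext _ (fun _ => 1)) in E; [|exact Ey].
    assert (E' := is_lim_seq_unique _ _ E); rewrite Lim_seq_const in E'; now injection E'. }
  assert (Lt : is_lim_seq (fun m => / r m) 0) by (apply (is_lim_seq_inv r p_infty); easy).
  assert (Lt2 := Sq _ _ Lt 2%nat); simpl pow at 2 in Lt2; rewrite Rmult_0_l in Lt2.
  set (t := fun m => (/ r m) ^ 2) in *; change (is_lim_seq t 0) in Lt2.
  (* Homogeneity: dividing by powers of r = |l| turns the curvature into a function of t = 1 / r^2
     and the direction (y1, y2). At t = 0 both denominators equal 1, so it is continuous there. *)
  set (F := fun t y1 y2 => - / (8 * PI ^ 2) * (K * t + 1) / K *
    ((y1 * k2 - k1 * y2) ^ 4 / ((K * t + 1) ^ 2 - 4 * t * (k1 * y1 + k2 * y2) ^ 2) +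
     (y1 * k2 + k1 * y2) ^ 4 / ((K * t + 1) ^ 2 - 4 * t * (k1 * y1 - k2 * y2) ^ 2))).
  apply (is_lim_seq_ext (fun m => F (t m) (y1 m) (y2 m))).
  { intros m; rewrite sec_curv_mode //; fold k1 k2 K; rewrite -Er.
    assert (El1 : INR (fst (l m)) = y1 m * r m) by (unfold y1; field; apply Rgt_not_eq, Hr).
    assert (El2 : INR (snd (l m)) = y2 m * r m) by (unfold y2; field; apply Rgt_not_eq, Hr).
    assert (Hkl : k1 <> INR (fst (l m))) by (intros E; now apply (H1 m), INR_eq).
    assert (D1 := curv_denominator_pos k1 k2 _ (INR (snd (l m))) (pos_INR _) (pos_INR _) Hkl).
    (* Reflecting k gives the second denominator. *)
    assert (D2 := curv_denominator_pos k1 (- k2) _ (INR (snd (l m))) (pos_INR _) (pos_INR _) Hkl).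
    replace (k1 ^ 2 + (- k2) ^ 2) with K in D2 by (unfold K; ring).
    fold K in D1; rewrite -Er in D1 D2; rewrite El1 El2 in D1 D2 |- *.
    unfold F, t; specialize (Hr m); revert Hr D1 D2; generalize (r m) (y1 m) (y2 m).
    intros R Y1 Y2 Hr D1 D2; field.
    assert (HPI := PI_RGT_0).
    repeat split; lra. }
  replace (_ * _) with (F 0 p q).
  - unfold F.
    assert (LC := is_lim_seq_const).
    assert (LA : is_lim_seq (fun m => K * t m + 1) (K * 0 + 1)).
    { apply is_lim_seq_plus' => //; apply is_lim_seq_mult' => //. }
    assert (LB : forall s, is_lim_seq
      (fun m => (K * t m + 1) ^ 2 - 4 * t m * (k1 * y1 m + s * y2 m) ^ 2)
      ((K * 0 + 1) ^ 2 - 4 * 0 * (k1 * p + s * q) ^ 2)).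
    { intros s; apply is_lim_seq_minus'; [now apply Sq|].
      apply is_lim_seq_mult'; [apply is_lim_seq_mult' => //|].
      apply Sq, is_lim_seq_plus'; apply is_lim_seq_mult' => //. }
    assert (LN : forall s, is_lim_seq (fun m => (y1 m * k2 + s * y2 m) ^ 4) ((p * k2 + s * q) ^ 4)).
    { intros s; apply Sq, is_lim_seq_plus'; apply is_lim_seq_mult' => //. }
    apply is_lim_seq_mult'.
    + apply is_lim_seq_div'; [|exact (LC K)|lra].
      apply is_lim_seq_mult' => //.
    + apply is_lim_seq_plus'; apply is_lim_seq_div'.
      * apply (is_lim_seq_ext (fun m => (y1 m * k2 + - k1 * y2 m) ^ 4)); [intros m; ring|].
        replace (p * k2 - k1 * q) with (p * k2 + - k1 * q) by ring; apply LN.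
      * apply LB.
      * apply Rgt_not_eq; ring_simplify; lra.
      * apply LN.
      * apply (is_lim_seq_ext (fun m => (K * t m + 1) ^ 2 - 4 * t m * (k1 * y1 m + - k2 * y2 m) ^ 2));
          [intros m; ring|].
        replace (k1 * p - k2 * q) with (k1 * p + - k2 * q) by ring; apply LB.
      * apply Rgt_not_eq; ring_simplify; lra.
  (* Up to sign, p k2 - k1 q and p k2 + k1 q are sqrt K times the sines of lambda - kappa and lambda
     + kappa. Their fourth powers give K^2, of which one factor cancels; the constant is 8 pi^2 = 2
     [S_T]. *)
  - destruct (cos_sin_ang k1 k2 (pos_INR _) (pos_INR _) HK) as [Ck Sk].
    destruct (cos_sin_ang p q Hp Hq) as [Cl Sl]; [lra|].
    rewrite Hpq sqrt_1 in Cl Sl.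
    fold K kappa in Ck, Sk; fold lambda in Cl, Sl.
    rewrite sin_minus sin_plus Ck Sk Cl Sl; unfold F, S_T; fold K.
    assert (HR : 0 < sqrt K) by now apply sqrt_lt_R0.
    assert (HPI := PI_RGT_0).
    assert (EK : sqrt K ^ 2 = K) by (rewrite pow2_sqrt; lra).
    revert HR EK; generalize (sqrt K); intros R HR EK; rewrite -EK.
    field; split; lra.
Qed.
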